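(* Let $\underline{\mathcal M}$ be an abelian braided monoidal category and $\underline B$ a Hopf algebra in $\underline{\mathcal M}$, with $\underline B^+=\ker\underline\varepsilon$. For any right ideal $I\subseteq\underline B^+$ (in $\underline{\mathcal M}$), with quotient map $\pi:\underline B^+\to\underline B^+/I$, one obtains a braided left covariant first order differential calculus $(\Omega^1(\underline B),\underline{\mathrm d}_I)$ on $\underline B$ by $$\Omega^1(\underline B):=\underline B\otimes(\underline B^+/I),\qquad \underline{\mathrm d}_I b:=(\mathrm{id}\otimes\pi)(\underline\Delta(b)-b\otimes1),$$ with $\underline B$-bimodule structure $$a\triangleright(b\otimes[c])=ab\otimes[c],\qquad (a\otimes[b])\triangleleft c=a\,{}_\alpha c^1\otimes{}^\alpha[b]\,c^2,$$ and left $\underline B$-coaction $\underline\Delta\otimes\mathrm{id}_{\underline B^+/I}$. If $\underline{\mathrm{coAd}}_{\mathrm R}(I)\subseteq I\otimes\underline B$, then $\Omega^1(\underline B)$ is a braided bicovariant first order differential calculus, with right $\underline B$-coaction $$a\otimes[b]\mapsto a^1\otimes{}_\alpha[b^2]\otimes{}^\alpha(a^2\underline S(b^1))\,b^3.$$ Moreover, every braided left covariant first order differential calculus over $\underline B$ is (up to isomorphism) of this form for some right ideal $I\subseteq \underline B^+$, and every braided bicovariant one is of this form with $\underline{\mathrm{coAd}}_{\mathrm R}(I)\subseteq I\otimes\underline B$.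
   Context: Associativity and unit constraints are omitted and element notation is used for morphisms in $\underline{\mathcal M}=(\underline{\mathcal M},\otimes,I,\sigma)$; the braiding is written $\sigma(x\otimes y)={}_\alpha y\otimes{}^\alpha x$ (summation understood). For an algebra $\underline B$ in $\underline{\mathcal M}$, $\underline B\otimes\underline B$ is an algebra via $(a\otimes b)(c\otimes d)=a\,{}_\alpha c\otimes{}^\alpha b\,d$. A Hopf algebra in $\underline{\mathcal M}$ is an algebra and coalgebra in $\underline{\mathcal M}$ whose coproduct $\underline\Delta(b)=b^1\otimes b^2$ and counit $\underline\varepsilon$ are algebra maps, with an antipode $\underline S$ (morphism in $\underline{\mathcal M}$), assumed bijective. Iterated coproducts are written $b^1\otimes b^2\otimes b^3$. The braided right adjoint coaction is $$\underline{\mathrm{coAd}}_{\mathrm R}:\underline B\to\underline B\otimes\underline B,\qquad b\mapsto{}_\alpha(b^2)\otimes\underline S({}^\alpha(b^1))\,b^3.$$ A first order differential calculus (FODC) over an algebra $\underline B$ in $\underline{\mathcal M}$ is a pair $(\Omega^1(\underline B),\underline{\mathrm d})$ with $\Omega^1(\underline B)$ a $\underline B$-bimodule in $\underline{\mathcal M}$ and $\underline{\mathrm d}:\underline B\to\Omega^1(\underline B)$ a morphism in $\underline{\mathcal M}$ satisfying $\underline{\mathrm d}(bb')=\underline{\mathrm d}(b)b'+b\,\underline{\mathrm d}(b')$, such that $\underline B\otimes\underline B\to\Omega^1(\underline B)$, $b\otimes b'\mapsto b\,\underline{\mathrm d}(b')$, is surjective. A FODC is braided left covariant if $\Omega^1(\underline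 B)$ carries a left $\underline B$-coaction ${}_{\Omega}\underline\Delta$ (in $\underline{\mathcal M}$) that is $\underline B$-bilinear, i.e. ${}_{\Omega}\underline\Delta(b\,\omega\,c)=\underline\Delta(b)\cdot{}_{\Omega}\underline\Delta(\omega)\cdot\underline\Delta(c)$ with $\underline B\otimes\Omega^1(\underline B)$ multiplied using the braiding, and ${}_{\Omega}\underline\Delta(\underline{\mathrm d}b)=b^1\otimes\underline{\mathrm d}b^2$. Braided right covariant is defined analogously with a right coaction; braided bicovariant means both. Isomorphisms of FODCi are bimodule isomorphisms in $\underline{\mathcal M}$ commuting with differentials (and colinear for the coactions present). *)

(* Defs.v *)
From mathcomp Require Import all_boot ssralg.
Set Implicit Arguments.
Unset Strict Implicit.
Unset Printing Implicit Defensive.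
Import GRing.Theory.
Local Open Scope ring_scope.

Reserved Notation "f ;; g" (at level 45, left associativity).
Reserved Notation "X ⊗ Y" (at level 40, left associativity).
Reserved Notation "f ⊠ g" (at level 40, left associativity).

(* Composition is written in diagrammatic order: f ;; g is "first f, then g". *)
Record preadditive_category := PreadditiveCategory {
  obj :> Type;
  hom : obj -> obj -> zmodType;
  idm : forall X, hom X X;
  compm : forall X Y Z, hom X Y -> hom Y Z -> hom X Z;
  compm_idl : forall X Y (f : hom X Y), compm (idm X) f = f;
  compm_idr : forall X Y (f : hom X Y), compm f (idm Y) = f;
  compmA : forall W X Y Z (f : hom W X) (g : hom X Y) (h : hom Y Z),
    compm f (compm g h) = compm (compm f g) h;
  compmDl : forall X Y Z (f f' : hom X Y) (g : hom Y Z),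
    compm (f + f') g = compm f g + compm f' g;
  compmDr : forall X Y Z (f : hom X Y) (g g' : hom Y Z),
    compm f (g + g') = compm f g + compm f g'
}.
Arguments hom {p} X Y.
Arguments idm {p} X.

Notation "f ;; g" := (compm f g).

Section CategoryNotions.
Variable C : preadditive_category.

Definition mono (X Y : C) (f : hom X Y) : Prop :=
  forall Z (g h : hom Z X), g ;; f = h ;; f -> g = h.

Definition epi (X Y : C) (f : hom X Y) : Prop :=
  forall Z (g h : hom Y Z), f ;; g = f ;; h -> g = h.

Definition is_inverse (X Y : C) (f : hom X Y) (g : hom Y X) : Prop :=
  f ;; g = idm X /\ g ;; f = idm Y.

Definition is_iso (X Y : C) (f : hom X Y) : Prop := exists g, is_inverse f g.

Definition is_kernel (X Y K : C) (f : hom X Y) (k : hom K X) : Prop :=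
  k ;; f = 0 /\
  forall Z (g : hom Z X), g ;; f = 0 -> exists! h : hom Z K, h ;; k = g.

Definition is_cokernel (X Y Q : C) (f : hom X Y) (q : hom Y Q) : Prop :=
  f ;; q = 0 /\
  forall Z (g : hom Y Z), f ;; g = 0 -> exists! h : hom Q Z, q ;; h = g.

End CategoryNotions.

Record abelian_category := AbelianCategory {
  abelian_preadditive :> preadditive_category;
  has_zero_object : exists Z : abelian_preadditive, idm Z = 0;
  has_biproducts : forall X Y : abelian_preadditive,
    exists (P : abelian_preadditive)
           (i1 : hom X P) (i2 : hom Y P) (p1 : hom P X) (p2 : hom P Y),
      [/\ i1 ;; p1 = idm X, i2 ;; p2 = idm Y, i1 ;; p2 = 0, i2 ;; p1 = 0
        & p1 ;; i1 + p2 ;; i2 = idm P];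
  ker_obj : forall X Y : abelian_preadditive, hom X Y -> abelian_preadditive;
  ker_inc : forall (X Y : abelian_preadditive) (f : hom X Y),
    hom (ker_obj f) X;
  ker_incP : forall (X Y : abelian_preadditive) (f : hom X Y),
    is_kernel f (ker_inc f);
  coker_obj : forall X Y : abelian_preadditive, hom X Y -> abelian_preadditive;
  coker_pr : forall (X Y : abelian_preadditive) (f : hom X Y),
    hom Y (coker_obj f);
  coker_prP : forall (X Y : abelian_preadditive) (f : hom X Y),
    is_cokernel f (coker_pr f);
  mono_is_kernel : forall (X Y : abelian_preadditive) (f : hom X Y),
    mono f -> exists (Z : abelian_preadditive) (g : hom Y Z), is_kernel g f;
  epi_is_cokernel : forall (X Y : abelian_preadditive) (f : hom X Y),
    epi f -> exists (Z : abelian_preadditive) (g : hom Z X), is_cokernel g f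
}.

Definition im_obj (C : abelian_category) (X Y : C) (f : hom X Y) : C :=
  ker_obj (coker_pr f).

Definition im_inc (C : abelian_category) (X Y : C) (f : hom X Y) :
  hom (im_obj f) Y := ker_inc (coker_pr f).

(* The inclusion im f ⊆ im g of subobjects of Z, expressed by saying that f
   factors through the subobject im g; when g is mono, im g is the subobject g
   itself. *)
Definition lands_in (C : abelian_category) (X Y Z : C)
    (f : hom X Z) (g : hom Y Z) : Prop :=
  exists h : hom X (im_obj g), h ;; im_inc g = f.

(* In an abelian monoidal category the tensor product is, as usual, required
   to be biadditive and right exact in each variable (it preserves cokernels).
   It is not required to be left exact. *)
Record abelian_monoidal_category := AbelianMonoidalCategory {
  monoidal_abelian :> abelian_category;
  tens : monoidal_abelian -> monoidal_abelian -> monoidal_abelian;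
  tensm : forall X X' Y Y' : monoidal_abelian,
    hom X X' -> hom Y Y' -> hom (tens X Y) (tens X' Y');
  unit_obj : monoidal_abelian;
  tensm_id : forall X Y, tensm (idm X) (idm Y) = idm (tens X Y);
  tensm_comp : forall (X X' X'' Y Y' Y'' : monoidal_abelian)
      (f : hom X X') (f' : hom X' X'') (g : hom Y Y') (g' : hom Y' Y''),
    tensm (f ;; f') (g ;; g') = tensm f g ;; tensm f' g';
  assoc : forall X Y Z, hom (tens (tens X Y) Z) (tens X (tens Y Z));
  assoc_inv : forall X Y Z, hom (tens X (tens Y Z)) (tens (tens X Y) Z);
  assocP : forall X Y Z, is_inverse (assoc X Y Z) (assoc_inv X Y Z);
  assoc_nat : forall (X X' Y Y' Z Z' : monoidal_abelian)
      (f : hom X X') (g : hom Y Y') (h : hom Z Z'),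
    tensm (tensm f g) h ;; assoc X' Y' Z'
    = assoc X Y Z ;; tensm f (tensm g h);
  lunit : forall X, hom (tens unit_obj X) X;
  lunit_inv : forall X, hom X (tens unit_obj X);
  lunitP : forall X, is_inverse (lunit X) (lunit_inv X);
  lunit_nat : forall (X X' : monoidal_abelian) (f : hom X X'),
    tensm (idm unit_obj) f ;; lunit X' = lunit X ;; f;
  runit : forall X, hom (tens X unit_obj) X;
  runit_inv : forall X, hom X (tens X unit_obj);
  runitP : forall X, is_inverse (runit X) (runit_inv X);
  runit_nat : forall (X X' : monoidal_abelian) (f : hom X X'),
    tensm f (idm unit_obj) ;; runit X' = runit X ;; f;
  pentagon : forall W X Y Z,
    tensm (assoc W X Y) (idm Z) ;; assoc W (tens X Y) Z
      ;; tensm (idm W) (assoc X Y Z)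
    = assoc (tens W X) Y Z ;; assoc W X (tens Y Z);
  triangle : forall X Y,
    assoc X unit_obj Y ;; tensm (idm X) (lunit Y) = tensm (runit X) (idm Y);
  tensmDl : forall (X X' Y Y' : monoidal_abelian)
      (f f' : hom X X') (g : hom Y Y'),
    tensm (f + f') g = tensm f g + tensm f' g;
  tensmDr : forall (X X' Y Y' : monoidal_abelian)
      (f : hom X X') (g g' : hom Y Y'),
    tensm f (g + g') = tensm f g + tensm f g';
  tens_cokerl : forall (W X Y Q : monoidal_abelian)
      (f : hom X Y) (q : hom Y Q),
    is_cokernel f q -> is_cokernel (tensm f (idm W)) (tensm q (idm W));
  tens_cokerr : forall (W X Y Q : monoidal_abelian)
      (f : hom X Y) (q : hom Y Q),
    is_cokernel f q -> is_cokernel (tensm (idm W) f) (tensm (idm W) q)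
}.
Arguments unit_obj {a}.
Arguments assoc {a} X Y Z.
Arguments assoc_inv {a} X Y Z.
Arguments lunit {a} X.
Arguments lunit_inv {a} X.
Arguments runit {a} X.
Arguments runit_inv {a} X.

Notation "X ⊗ Y" := (tens X Y).
Notation "f ⊠ g" := (tensm f g).

Record abelian_braided_category := AbelianBraidedCategory {
  braided_monoidal :> abelian_monoidal_category;
  braid : forall X Y : braided_monoidal, hom (X ⊗ Y) (Y ⊗ X);
  braid_iso : forall X Y, is_iso (braid X Y);
  braid_nat : forall (X X' Y Y' : braided_monoidal)
      (f : hom X X') (g : hom Y Y'),
    (f ⊠ g) ;; braid X' Y' = braid X Y ;; (g ⊠ f);
  hexagon_r : forall X Y Z,
    assoc X Y Z ;; braid X (Y ⊗ Z) ;; assoc Y Z X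
    = (braid X Y ⊠ idm Z) ;; assoc Y X Z ;; (idm Y ⊠ braid X Z);
  hexagon_l : forall X Y Z,
    assoc_inv X Y Z ;; braid (X ⊗ Y) Z ;; assoc_inv Z X Y
    = (idm X ⊠ braid Y Z) ;; assoc_inv X Z Y ;; (braid X Z ⊠ idm Y)
}.
Arguments braid {a} X Y.

Section BraidedNotions.
Variable M : abelian_braided_category.

(* x ⊗ (y ⊗ z) |-> _α y ⊗ (^α x ⊗ z) *)
Definition braid_past (X Y Z : M) : hom (X ⊗ (Y ⊗ Z)) (Y ⊗ (X ⊗ Z)) :=
  assoc_inv X Y Z ;; (braid X Y ⊠ idm Z) ;; assoc Y X Z.

(* (w ⊗ x) ⊗ (y ⊗ z) |-> (w ⊗ _α y) ⊗ (^α x ⊗ z) *)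
Definition mid_braid (W X Y Z : M) :
    hom ((W ⊗ X) ⊗ (Y ⊗ Z)) ((W ⊗ Y) ⊗ (X ⊗ Z)) :=
  assoc W X (Y ⊗ Z) ;; (idm W ⊠ braid_past X Y Z) ;; assoc_inv W Y (X ⊗ Z).

Record algebra := BraidedAlgebra {
  alg_obj :> M;
  mul : hom (alg_obj ⊗ alg_obj) alg_obj;
  one : hom unit_obj alg_obj;
  mulA : (mul ⊠ idm alg_obj) ;; mul
    = assoc alg_obj alg_obj alg_obj ;; (idm alg_obj ⊠ mul) ;; mul;
  mul1l : (one ⊠ idm alg_obj) ;; mul = lunit alg_obj;
  mul1r : (idm alg_obj ⊠ one) ;; mul = runit alg_obj
}.

Definition braided_mul (A : algebra) : hom ((A ⊗ A) ⊗ (A ⊗ A)) (A ⊗ A) :=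
  mid_braid A A A A ;; (mul A ⊠ mul A).

Record hopf_algebra := HopfAlgebra {
  hopf_alg :> algebra;
  Δ : hom hopf_alg (hopf_alg ⊗ hopf_alg);
  ε : hom hopf_alg unit_obj;
  antipode : hom hopf_alg hopf_alg;
  ΔA : Δ ;; (Δ ⊠ idm hopf_alg) ;; assoc hopf_alg hopf_alg hopf_alg
    = Δ ;; (idm hopf_alg ⊠ Δ);
  Δ_counitl : Δ ;; (ε ⊠ idm hopf_alg) ;; lunit hopf_alg = idm hopf_alg;
  Δ_counitr : Δ ;; (idm hopf_alg ⊠ ε) ;; runit hopf_alg = idm hopf_alg;
  Δ_mul : mul hopf_alg ;; Δ = (Δ ⊠ Δ) ;; braided_mul hopf_alg;
  Δ_one : one hopf_alg ;; Δ
    = lunit_inv unit_obj ;; (one hopf_alg ⊠ one hopf_alg);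
  ε_mul : mul hopf_alg ;; ε = (ε ⊠ ε) ;; lunit unit_obj;
  ε_one : one hopf_alg ;; ε = idm unit_obj;
  antipodel : Δ ;; (antipode ⊠ idm hopf_alg) ;; mul hopf_alg
    = ε ;; one hopf_alg;
  antipoder : Δ ;; (idm hopf_alg ⊠ antipode) ;; mul hopf_alg
    = ε ;; one hopf_alg;
  antipode_iso : is_iso antipode
}.

Section Calculi.
Variable A : algebra.

Record calculus_data := CalculusData {
  forms :> M;
  lact : hom (A ⊗ forms) forms;
  ract : hom (forms ⊗ A) forms;
  diff : hom A forms
}.

Definition is_bimodule (W : calculus_data) : Prop :=
  [/\ (mul A ⊠ idm W) ;; lact W
        = assoc A A W ;; (idm A ⊠ lact W) ;; lact W
      /\ (one A ⊠ idm W) ;; lact W = lunit W,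
      assoc W A A ;; (idm W ⊠ mul A) ;; ract W
        = (ract W ⊠ idm A) ;; ract W
      /\ (idm W ⊠ one A) ;; ract W = runit W
    & (lact W ⊠ idm A) ;; ract W
        = assoc A W A ;; (idm A ⊠ ract W) ;; lact W].

Definition is_fodc (W : calculus_data) : Prop :=
  [/\ is_bimodule W,
      mul A ;; diff W
        = (diff W ⊠ idm A) ;; ract W + (idm A ⊠ diff W) ;; lact W
    & epi ((idm A ⊠ diff W) ;; lact W)].

Definition is_fodc_iso (W W' : calculus_data) (φ : hom W W') : Prop :=
  [/\ is_iso φ,
      lact W ;; φ = (idm A ⊠ φ) ;; lact W',
      ract W ;; φ = (φ ⊠ idm A) ;; ract W'
    & diff W ;; φ = diff W'].

End Calculi.

Section Covariance.
Variable B : hopf_algebra.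

Definition is_left_coaction (V : M) (δ : hom V (B ⊗ V)) : Prop :=
  δ ;; (Δ B ⊠ idm V) ;; assoc B B V = δ ;; (idm B ⊠ δ)
  /\ δ ;; (ε B ⊠ idm V) ;; lunit V = idm V.

Definition is_right_coaction (V : M) (δ : hom V (V ⊗ B)) : Prop :=
  δ ;; (δ ⊠ idm B) ;; assoc V B B = δ ;; (idm V ⊠ Δ B)
  /\ δ ;; (idm V ⊠ ε B) ;; runit V = idm V.

Definition left_covariant (W : calculus_data B) (δl : hom W (B ⊗ W)) : Prop :=
  [/\ is_fodc W,
      is_left_coaction δl,
      (lact W ⊠ idm B) ;; ract W ;; δl
        = ((Δ B ⊠ δl) ⊠ Δ B)
          ;; ((mid_braid B B B W ;; (mul B ⊠ lact W)) ⊠ idm (B ⊗ B))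
          ;; mid_braid B W B B ;; (mul B ⊠ ract W)
    & diff W ;; δl = Δ B ;; (idm B ⊠ diff W)].

Definition right_covariant (W : calculus_data B) (δr : hom W (W ⊗ B)) : Prop :=
  [/\ is_fodc W,
      is_right_coaction δr,
      (lact W ⊠ idm B) ;; ract W ;; δr
        = ((Δ B ⊠ δr) ⊠ Δ B)
          ;; ((mid_braid B B W B ;; (lact W ⊠ mul B)) ⊠ idm (B ⊗ B))
          ;; mid_braid W B B B ;; (ract W ⊠ mul B)
    & diff W ;; δr = Δ B ;; (diff W ⊠ idm B)].

Definition bicovariant (W : calculus_data B)
    (δl : hom W (B ⊗ W)) (δr : hom W (W ⊗ B)) : Prop :=
  left_covariant δl /\ right_covariant δr.

Definition left_colinear (V V' : M) (δ : hom V (B ⊗ V)) (δ' : hom V' (B ⊗ V'))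
    (φ : hom V V') : Prop := φ ;; δ' = δ ;; (idm B ⊠ φ).

Definition right_colinear (V V' : M) (δ : hom V (V ⊗ B)) (δ' : hom V' (V' ⊗ B))
    (φ : hom V V') : Prop := φ ;; δ' = δ ;; (φ ⊠ idm B).

(* b |-> _α(b²) ⊗ S(^α(b¹)) b³ *)
Definition coAdR : hom B (B ⊗ B) :=
  Δ B ;; (idm B ⊠ Δ B) ;; braid_past B B B
  ;; (idm B ⊠ (antipode B ⊠ idm B)) ;; (idm B ⊠ mul B).

Definition aug : M := ker_obj (ε B).

Definition aug_inc : hom aug B := ker_inc (ε B).

Lemma aug_proj_ex : exists p : hom B aug, p ;; aug_inc == idm B - ε B ;; one B.
Proof.
have [_ kerU] := ker_incP (ε B).
have compNl X Y Z (f : hom (p := M) X Y) (g : hom Y Z) : (- f) ;; g = - (f ;; g).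
  have c0 : (0 : hom X Y) ;; g = 0.
    by apply: (addrI ((0 : hom X Y) ;; g)); rewrite -compmDl !addr0.
  by apply/eqP; rewrite -addr_eq0 -compmDl addNr c0.
have e0 : (idm B - ε B ;; one B) ;; ε B = 0.
  by rewrite compmDl compNl -compmA ε_one compm_idl compm_idr subrr.
by have [p [pE _]] := kerU _ _ e0; exists p; apply/eqP.
Qed.

(* The retraction b |-> b - ε(b) 1 of B onto B⁺. *)
Definition aug_proj : hom B aug := xchoose aug_proj_ex.

Lemma aug_projE : aug_proj ;; aug_inc = idm B - ε B ;; one B.
Proof. exact/eqP/(xchooseP aug_proj_ex). Qed.

Lemma aug_incK : aug_inc ;; aug_proj = idm aug.
Proof.
have [k0 kerU] := ker_incP (ε B).
have [h [_ hU]] := kerU _ aug_inc k0.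
rewrite -[RHS]hU ?compm_idl //; symmetry; apply: hU.
have c0 : (0 : hom aug unit_obj) ;; one B = 0.
  apply: (addrI ((0 : hom aug unit_obj) ;; one B)).
  by rewrite -compmDl !addr0.
have cN : aug_inc ;; (- (ε B ;; one B)) = 0.
  apply: (addrI (aug_inc ;; (ε B ;; one B))).
  rewrite -compmDr subrr addr0 compmA k0 c0.
  apply: (addrI (aug_inc ;; (0 : hom B B))).
  by rewrite -compmDr !addr0.
by rewrite -compmA aug_projE compmDr cN addr0 compm_idr.
Qed.

(* A right ideal of B contained in B⁺: a subobject I of B⁺ with I · B ⊆ I. *)
Record right_ideal := RightIdeal {
  ideal_obj :> M;
  ideal_inc : hom ideal_obj aug;
  ideal_mono : mono ideal_inc;
  ideal_stable : exists m : hom (ideal_obj ⊗ B) ideal_obj,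
    ((ideal_inc ;; aug_inc) ⊠ idm B) ;; mul B = m ;; (ideal_inc ;; aug_inc)
}.

Definition coAdR_stable (I : right_ideal) : Prop :=
  lands_in (ideal_inc I ;; aug_inc ;; coAdR)
           ((ideal_inc I ;; aug_inc) ⊠ idm B).

Section IdealCalculus.
Variable I : right_ideal.

Definition quot : M := coker_obj (ideal_inc I).

Definition quot_pr : hom aug quot := coker_pr (ideal_inc I).

(* Square brackets, extended from B⁺ to B by b |-> [b - ε(b) 1].  The
   expressions Δ(b) - b ⊗ 1 in the differential and _α(b²) ⊗ S(^α(b¹)) b³ (for
   b in B⁺) in the right coaction lie in B ⊗ B⁺ and B⁺ ⊗ B respectively, where
   the extension does not matter by aug_incK. *)
Definition cls : hom B quot := aug_proj ;; quot_pr.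

Lemma quot_act_ex : exists r : hom (quot ⊗ B) quot,
  (quot_pr ⊠ idm B) ;; r == (aug_inc ⊠ idm B) ;; mul B ;; cls.
Proof.
have [q0 _] := coker_prP (ideal_inc I).
have [_ cokU] := tens_cokerl B (coker_prP (ideal_inc I)).
have [m mE] := ideal_stable I.
have /cokU : (ideal_inc I ⊠ idm B) ;; ((aug_inc ⊠ idm B) ;; mul B ;; cls) = 0.
  rewrite !compmA -tensm_comp compm_idl mE /cls -!compmA (compmA aug_inc) aug_incK.
  rewrite compm_idl q0.
  apply: (addrI (m ;; (0 : hom I quot))).
  by rewrite -compmDr !addr0.
by case=> r [rE _]; exists r; apply/eqP.
Qed.

(* The induced right action [b] ⊗ c |-> [b c]. *)
Definition quot_act : hom (quot ⊗ B) quot := xchoose quot_act_ex.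

(* On Ω = B ⊗ (B⁺/I):
     a ▷ (b ⊗ [c]) = a b ⊗ [c],
     (a ⊗ [b]) ◁ c = a _α(c¹) ⊗ ^α[b] c²,
     d b = (id ⊗ π)(Δ(b) - b ⊗ 1). *)
Definition ideal_calculus : calculus_data B := {|
  forms := B ⊗ quot;
  lact := assoc_inv B B quot ;; (mul B ⊠ idm quot);
  ract := (idm (B ⊗ quot) ⊠ Δ B) ;; mid_braid B quot B B
          ;; (mul B ⊠ quot_act);
  diff := (Δ B - runit_inv B ;; (idm B ⊠ one B)) ;; (idm B ⊠ cls)
|}.

Definition ideal_lcoact : hom ideal_calculus (B ⊗ ideal_calculus) :=
  (Δ B ⊠ idm quot) ;; assoc B B quot.

(* b ⊗ ([c] ⊗ e) |-> _α[c] ⊗ ^α b e *)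
Let braid_mul : hom (B ⊗ (quot ⊗ B)) (quot ⊗ B) :=
  braid_past B quot B ;; (idm quot ⊠ mul B).

(* a ⊗ b |-> a¹ ⊗ _α[b²] ⊗ ^α(a² S(b¹)) b³ on B ⊗ B⁺ *)
Definition rcoact_formula : hom (B ⊗ aug) ((B ⊗ quot) ⊗ B) :=
  (Δ B ⊠ (aug_inc ;; Δ B ;; (idm B ⊠ Δ B)))
  ;; (idm (B ⊗ B) ⊠ (antipode B ⊠ (cls ⊠ idm B)))
  ;; assoc B B (B ⊗ (quot ⊗ B))
  ;; (idm B ⊠ (assoc_inv B B (quot ⊗ B)
               ;; (mul B ⊠ idm (quot ⊗ B)) ;; braid_mul))
  ;; assoc_inv B quot B.

Definition is_ideal_rcoact
    (δr : hom ideal_calculus (ideal_calculus ⊗ B)) : Prop :=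
  (idm B ⊠ quot_pr) ;; δr = rcoact_formula.

End IdealCalculus.
End Covariance.
End BraidedNotions.

(* Main.v *)
(* Tensoring a morphism with a trailing object Z and flattening all brackets
   makes the associators and unit constraints disappear, so that the element
   calculus of string diagrams can be used for the coherence arguments.

   The Galois map a ⊗ b |-> a b¹ ⊗ b² is invertible and turns a ⊗ b |-> a db
   into a ⊗ b |-> a S(b¹) d b², that is, into left multiplication applied to the
   Maurer-Cartan form ϖ(b) = S(b¹) d b².  Since (a db) c = a d(bc) - ab dc, a left
   linear map out of Ω¹(B) that is compatible with d is automatically right
   linear; so the coactions and isomorphisms only have to be controlled on
   elements a db.  Conversely, for a left covariant calculus the
   right ideal is the kernel of ϖ on B⁺: the identity
   ϖ(bc) = _αS(c¹) ϖ(^αb) c² + ε(b) ϖ(c) shows that it is a right ideal, ϖ is left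
   coinvariant, and ω |-> ω_(-2) ⊗ S(ω_(-1)) ω_0 inverts a ⊗ [b] |-> a ϖ(b), as
   for Hopf modules. *)
From mathcomp Require Import all_boot ssralg.
Import GRing.Theory.
Require Import Defs.
Set Implicit Arguments.
Unset Strict Implicit.
Unset Printing Implicit Defensive.
Local Open Scope ring_scope.

(** * Preadditive and monoidal categories *)

Section Preadditive.
Variable C : preadditive_category.
Implicit Types X Y Z : C.

Lemma comp0m X Y Z (g : hom Y Z) : (0 : hom X Y) ;; g = 0.
Proof. by apply: (addrI ((0 : hom X Y) ;; g)); rewrite -compmDl !addr0. Qed.

Lemma compm0 X Y Z (f : hom X Y) : f ;; (0 : hom Y Z) = 0.
Proof. by apply: (addrI (f ;; (0 : hom Y Z))); rewrite -compmDr !addr0. Qed.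

Lemma compNm X Y Z (f : hom X Y) (g : hom Y Z) : (- f) ;; g = - (f ;; g).
Proof. by apply/eqP; rewrite -addr_eq0 -compmDl addNr comp0m. Qed.

Lemma compmN X Y Z (f : hom X Y) (g : hom Y Z) : f ;; (- g) = - (f ;; g).
Proof. by apply/eqP; rewrite -addr_eq0 -compmDr addNr compm0. Qed.

Lemma compmBl X Y Z (f f' : hom X Y) (g : hom Y Z) :
  (f - f') ;; g = f ;; g - f' ;; g.
Proof. by rewrite compmDl compNm. Qed.

Lemma compmBr X Y Z (f : hom X Y) (g g' : hom Y Z) :
  f ;; (g - g') = f ;; g - f ;; g'.
Proof. by rewrite compmDr compmN. Qed.

Lemma iso_epi X Y (f : hom X Y) (g : hom Y X) : is_inverse f g -> epi f.
Proof.
move=> [_ gf] Z h k E.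
by rewrite -[h]compm_idl -[k]compm_idl -gf -!compmA E.
Qed.

Lemma comp_epi X Y Z (f : hom X Y) (g : hom Y Z) : epi f -> epi g -> epi (f ;; g).
Proof. by move=> ef eg W h k; rewrite -!compmA => /ef /eg. Qed.

Lemma epi_comp X Y Z (f : hom X Y) (g : hom Y Z) : epi (f ;; g) -> epi g.
Proof. by move=> efg W h k E; apply: efg; rewrite -!compmA E. Qed.

Lemma cokernel_epi X Y Q (f : hom X Y) (q : hom Y Q) : is_cokernel f q -> epi q.
Proof.
move=> [fq qU] Z g h E.
have [k [_ kU]] := qU _ (q ;; g) (etrans (compmA _ _ _)
   (etrans (congr1 (fun u => u ;; g) fq) (comp0m _ _))).
by rewrite -(kU g) // (kU h).
Qed.

Lemma kernel_mono X Y K (f : hom X Y) (k : hom K X) : is_kernel f k -> mono k.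
Proof.
move=> [kf kU] Z g h E.
have [u [_ uU]] := kU _ (g ;; k) (etrans (esym (compmA _ _ _))
   (etrans (congr1 (fun u => g ;; u) kf) (compm0 _ _))).
by rewrite -(uU g) // (uU h).
Qed.

End Preadditive.

Section Monoidal.
Variable M : abelian_monoidal_category.
Implicit Types X Y Z W : M.

Lemma tens_comp_l X X' X'' Y (f : hom X X') (f' : hom X' X'') :
  (f ;; f') ⊠ idm Y = (f ⊠ idm Y) ;; (f' ⊠ idm Y).
Proof. by rewrite -tensm_comp compm_idl. Qed.

Lemma tens_comp_r X X' X'' Y (f : hom X X') (f' : hom X' X'') :
  idm Y ⊠ (f ;; f') = (idm Y ⊠ f) ;; (idm Y ⊠ f').
Proof. by rewrite -tensm_comp compm_idl. Qed.

Lemma tens_lr X X' Y Y' (f : hom X X') (g : hom Y Y') :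
  f ⊠ g = (f ⊠ idm Y) ;; (idm X' ⊠ g).
Proof. by rewrite -tensm_comp compm_idl compm_idr. Qed.

Lemma tens_rl X X' Y Y' (f : hom X X') (g : hom Y Y') :
  f ⊠ g = (idm X ⊠ g) ;; (f ⊠ idm Y').
Proof. by rewrite -tensm_comp compm_idl compm_idr. Qed.

Lemma tens0m X X' Y Y' (g : hom Y Y') : (0 : hom X X') ⊠ g = 0.
Proof. by apply: (addrI ((0 : hom X X') ⊠ g)); rewrite -tensmDl !addr0. Qed.

Lemma tensm0 X X' Y Y' (f : hom X X') : f ⊠ (0 : hom Y Y') = 0.
Proof. by apply: (addrI (f ⊠ (0 : hom Y Y'))); rewrite -tensmDr !addr0. Qed.

Lemma tensmBl X X' Y Y' (f f' : hom X X') (g : hom Y Y') :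
  (f - f') ⊠ g = f ⊠ g - f' ⊠ g.
Proof.
rewrite tensmDl; congr (_ + _); apply/eqP.
by rewrite -addr_eq0 -tensmDl addNr tens0m.
Qed.

Lemma tensmBr X X' Y Y' (f : hom X X') (g g' : hom Y Y') :
  f ⊠ (g - g') = f ⊠ g - f ⊠ g'.
Proof.
rewrite tensmDr; congr (_ + _); apply/eqP.
by rewrite -addr_eq0 -tensmDr addNr tensm0.
Qed.

Lemma epi_tensl X Y W (f : hom X Y) : epi f -> epi (f ⊠ idm W).
Proof.
by move=> /epi_is_cokernel [Z [g gf]]; apply/cokernel_epi/(tens_cokerl W gf).
Qed.

Lemma epi_tensr X Y W (f : hom X Y) : epi f -> epi (idm W ⊠ f).
Proof.
by move=> /epi_is_cokernel [Z [g gf]]; apply/cokernel_epi/(tens_cokerr W gf).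
Qed.

Lemma lunit_faithful X Y (f g : hom X Y) :
  idm unit_obj ⊠ f = idm unit_obj ⊠ g -> f = g.
Proof.
move=> E; have [l1 l2] := lunitP X.
by apply: (iso_epi (lunitP X)); rewrite -!lunit_nat E.
Qed.

Lemma runit_faithful X Y (f g : hom X Y) :
  f ⊠ idm unit_obj = g ⊠ idm unit_obj -> f = g.
Proof. by move=> E; apply: (iso_epi (runitP X)); rewrite -!runit_nat E. Qed.

Lemma inverse_tens X X' Y Y' (f : hom X X') f' (g : hom Y Y') g' :
  is_inverse f f' -> is_inverse g g' -> is_inverse (f ⊠ g) (f' ⊠ g').
Proof.
by move=> [a b] [c d]; split; rewrite -tensm_comp ?a ?b ?c ?d tensm_id.
Qed.

Lemma inverse_id X : is_inverse (idm X) (idm X).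
Proof. by split; rewrite compm_idl. Qed.

(* Kelly's argument: both sides agree after tensoring with the unit object and
   precomposing with associators, by the pentagon and the triangle. *)
Lemma lunit_tens X Y : assoc unit_obj X Y ;; lunit (X ⊗ Y) = lunit X ⊠ idm Y.
Proof.
apply: lunit_faithful.
have E1 := iso_epi (inverse_tens (assocP unit_obj unit_obj X) (inverse_id Y)).
have E2 := iso_epi (assocP (unit_obj : M) (unit_obj ⊗ X) Y).
apply: (comp_epi E1 E2).
rewrite tens_comp_r compmA pentagon -!compmA triangle.
rewrite -(tensm_id X Y) -!assoc_nat !compmA; congr (_ ;; _).
by rewrite -tensm_comp triangle compm_idl.
Qed.

End Monoidal.

(** * Strictification *)

Section Strictification.
Variable M : abelian_braided_category.

Inductive tree := Leaf of M | Unit | Node of tree & tree.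

Fixpoint ob (t : tree) : M :=
  match t with
  | Leaf X => X
  | Unit => unit_obj
  | Node a b => ob a ⊗ ob b
  end.

(** Leaves bracketed to the right in front of [Z], with units dropped. Since this computes, source
    and target of an associator or unit constraint become convertible. *)
Fixpoint stack (t : tree) (Z : M) : M :=
  match t with
  | Leaf X => X ⊗ Z
  | Unit => Z
  | Node a b => stack a (stack b Z)
  end.

Fixpoint stackm (t : tree) (Z Z' : M) (h : hom Z Z') :
    hom (stack t Z) (stack t Z') :=
  match t return hom (stack t Z) (stack t Z') with
  | Leaf X => idm X ⊠ h
  | Unit => h
  | Node a b => stackm a (stackm b h)
  end.

Fixpoint flat (t : tree) (Z : M) : hom (ob t ⊗ Z) (stack t Z) :=
  match t return hom (ob t ⊗ Z) (stack t Z) with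
  | Leaf X => idm (X ⊗ Z)
  | Unit => lunit Z
  | Node a b =>
      assoc (ob a) (ob b) Z ;; (idm (ob a) ⊠ flat b Z) ;; flat a (stack b Z)
  end.

Fixpoint unflat (t : tree) (Z : M) : hom (stack t Z) (ob t ⊗ Z) :=
  match t return hom (stack t Z) (ob t ⊗ Z) with
  | Leaf X => idm (X ⊗ Z)
  | Unit => lunit_inv Z
  | Node a b =>
      unflat a (stack b Z) ;; (idm (ob a) ⊠ unflat b Z)
        ;; assoc_inv (ob a) (ob b) Z
  end.

Lemma flatP (t : tree) (Z : M) : is_inverse (flat t Z) (unflat t Z).
Proof.
elim: t Z => [X|| a IHa b IHb] Z; [exact: inverse_id | exact: lunitP |].
have [a1 a2] := IHa (stack b Z); have [b1 b2] := IHb Z.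
have [c1 c2] := assocP (ob a) (ob b) Z.
split=> /=.
  rewrite !compmA -(compmA _ (flat _ _)) a1 compm_idr.
  rewrite -(compmA _ (_ ⊠ _) (_ ⊠ _)).
  by rewrite -tens_comp_r b1 tensm_id compm_idr.
rewrite !compmA -(compmA _ (assoc_inv _ _ _)) c2 compm_idr.
rewrite -(compmA _ (_ ⊠ _) (_ ⊠ _)).
by rewrite -tens_comp_r b2 tensm_id compm_idr.
Qed.

Lemma stackm_id t Z : stackm t (idm Z) = idm (stack t Z).
Proof. by elim: t Z => //= [X|a IHa b IHb] Z; rewrite ?tensm_id ?IHb ?IHa. Qed.

Lemma stackm_comp t Z Z' Z'' (h : hom Z Z') (k : hom Z' Z'') :
  stackm t (h ;; k) = stackm t h ;; stackm t k.
Proof.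
elim: t Z Z' Z'' h k => //= [X|a IHa b IHb] Z Z' Z'' h k.
  exact: tens_comp_r.
by rewrite IHb IHa.
Qed.

Lemma flat_nat t Z Z' (h : hom Z Z') :
  (idm (ob t) ⊠ h) ;; flat t Z' = flat t Z ;; stackm t h.
Proof.
elim: t Z Z' h => //= [X|| a IHa b IHb] Z Z' h.
- by rewrite compm_idl compm_idr.
- exact: lunit_nat.
rewrite -(tensm_id (ob a) (ob b)) !compmA assoc_nat -(compmA (assoc _ _ _)).
by rewrite -tens_comp_r IHb tens_comp_r -!compmA IHa.
Qed.

Definition strict (s t : tree) (f : hom (ob s) (ob t)) (Z : M) :
    hom (stack s Z) (stack t Z) :=
  unflat s Z ;; (f ⊠ idm Z) ;; flat t Z.

Lemma strict_nat s t (f : hom (ob s) (ob t)) Z Z' (h : hom Z Z') :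
  stackm s h ;; strict f Z' = strict f Z ;; stackm t h.
Proof.
apply: (iso_epi (flatP s Z)); rewrite /strict !compmA -flat_nat.
have [s1 _] := flatP s Z; have [s2 _] := flatP s Z'.
rewrite s1 compm_idl -(compmA _ (flat s Z')) s2 compm_idr -tens_rl.
by rewrite -(compmA _ (flat t Z)) -flat_nat !compmA -tens_lr.
Qed.

Lemma strict_id s Z : strict (idm (ob s)) Z = idm (stack s Z).
Proof.
by rewrite /strict tensm_id compm_idr; have [_ ->] := flatP s Z.
Qed.

Lemma strict_comp s t u (f : hom (ob s) (ob t)) (g : hom (ob t) (ob u)) Z :
  strict (f ;; g) Z = strict f Z ;; strict g Z.
Proof.
rewrite /strict tens_comp_l !compmA -(compmA _ (flat t Z)).
by have [-> _] := flatP t Z; rewrite compm_idr.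
Qed.

(** After flattening, a tensor product is a composite: [f] acts with everything to its right as
    trailing object, then [g] acts further in. *)
Lemma strict_tens s t s' t' (f : hom (ob s) (ob t)) (g : hom (ob s') (ob t')) Z :
  strict (s := Node s s') (t := Node t t') (f ⊠ g) Z
  = strict f (stack s' Z) ;; stackm t (strict g Z).
Proof.
rewrite /strict /= !compmA.
rewrite -(compmA _ ((f ⊠ g) ⊠ idm Z)) assoc_nat !compmA.
rewrite -(compmA _ (assoc_inv _ _ _)).
have [_ ->] := assocP (ob s) (ob s') Z; rewrite compm_idr.
rewrite -(compmA _ (flat t _) (stackm _ _)) -flat_nat !compmA; congr (_ ;; _).
by rewrite -!compmA -!tensm_comp !compm_idl compm_idr compmA.
Qed.

Lemma flat_assoc a b c Z :
  (assoc (ob a) (ob b) (ob c) ⊠ idm Z) ;; flat (Node a (Node b c)) Z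
  = flat (Node (Node a b) c) Z.
Proof.
rewrite /= !tens_comp_r !compmA pentagon; congr (_ ;; _ ;; _).
rewrite -(compmA _ (assoc _ _ _) (_ ⊠ _)) -assoc_nat tensm_id.
by rewrite !compmA.
Qed.

Lemma strict_assoc a b c Z :
  strict (s := Node (Node a b) c) (t := Node a (Node b c))
    (assoc (ob a) (ob b) (ob c)) Z = idm _.
Proof.
rewrite /strict -compmA flat_assoc.
by have [_ ->] := flatP (Node (Node a b) c) Z.
Qed.

Lemma strict_assoc_inv a b c Z :
  strict (s := Node a (Node b c)) (t := Node (Node a b) c)
    (assoc_inv (ob a) (ob b) (ob c)) Z = idm _.
Proof.
have := @strict_comp (Node a (Node b c)) (Node (Node a b) c)
  (Node a (Node b c)) (assoc_inv _ _ _) (assoc _ _ _) Z.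
have [_ ->] := assocP (ob a) (ob b) (ob c).
by rewrite (strict_id (Node _ _)) strict_assoc compm_idr => <-.
Qed.

Lemma strict_lunit a Z :
  strict (s := Node Unit a) (t := a) (lunit (ob a)) Z = idm _.
Proof.
rewrite /strict -compmA -lunit_tens -(compmA _ (lunit _)) -lunit_nat.
rewrite (compmA (assoc _ _ _)).
by have [_ E] := flatP (Node Unit a) Z; apply: E.
Qed.

Lemma strict_lunit_inv a Z :
  strict (s := a) (t := Node Unit a) (lunit_inv (ob a)) Z = idm _.
Proof.
have := @strict_comp a (Node Unit a) a (lunit_inv _) (lunit _) Z.
have [_ ->] := lunitP (ob a).
by rewrite strict_id strict_lunit compm_idr => <-.
Qed.

Lemma strict_runit a Z :
  strict (s := Node a Unit) (t := a) (runit (ob a)) Z = idm _.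
Proof.
rewrite /strict -compmA -triangle.
by have [_ E] := flatP (Node a Unit) Z; apply: E.
Qed.

Lemma strict_runit_inv a Z :
  strict (s := a) (t := Node a Unit) (runit_inv (ob a)) Z = idm _.
Proof.
have := @strict_comp a (Node a Unit) a (runit_inv _) (runit _) Z.
have [_ ->] := runitP (ob a).
by rewrite strict_id strict_runit compm_idr => <-.
Qed.

(** Undoing the flattening recovers [f ⊠ idm unit_obj], and tensoring with the unit object is
    faithful. *)
Lemma strict_faithful s t (f g : hom (ob s) (ob t)) :
  strict f unit_obj = strict g unit_obj -> f = g.
Proof.
have K (h : hom (ob s) (ob t)) :
    h ⊠ idm unit_obj = flat s unit_obj ;; strict h unit_obj ;; unflat t unit_obj.
  rewrite /strict !compmA -(compmA _ (flat t _)).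
  have [-> _] := flatP s unit_obj; have [-> _] := flatP t unit_obj.
  by rewrite compm_idl compm_idr.
by move=> E; apply: runit_faithful; rewrite !K E.
Qed.

Definition sbraid a b Z : hom (stack a (stack b Z)) (stack b (stack a Z)) :=
  strict (s := Node a b) (t := Node b a) (braid (ob a) (ob b)) Z.

Lemma sbraid_nat s s' t t' (f : hom (ob s) (ob t)) (g : hom (ob s') (ob t')) Z :
  strict f (stack s' Z) ;; stackm t (strict g Z) ;; sbraid t t' Z
  = sbraid s s' Z ;; strict g (stack s Z) ;; stackm t' (strict f Z).
Proof.
rewrite /sbraid.
have := congr1 (fun f => strict (s := Node s s') (t := Node t' t) f Z)
  (braid_nat f g).
rewrite (strict_comp (t := Node t t')) (strict_comp (t := Node s' s)).
by move=> E; rewrite strict_tens in E; rewrite E strict_tens compmA.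
Qed.

Lemma sbraid_node_r a b c Z :
  sbraid a (Node b c) Z
  = sbraid a b (stack c Z) ;; stackm b (sbraid a c Z).
Proof.
have := congr1 (fun f => strict (s := Node (Node a b) c)
  (t := Node b (Node c a)) f Z) (hexagon_r (ob a) (ob b) (ob c)).
rewrite (strict_comp (t := Node (Node b c) a)).
rewrite (strict_comp (t := Node a (Node b c))).
rewrite strict_assoc strict_assoc compm_idl compm_idr => E.
apply: (etrans E) => {E}.
rewrite (strict_comp (t := Node b (Node a c))).
rewrite (strict_comp (t := Node (Node b a) c)).
rewrite (strict_tens (s := Node a b) (t := Node b a)) strict_id stackm_id.
rewrite strict_assoc !compm_idr.
rewrite (strict_tens (s' := Node a c) (t' := Node c a)) strict_id.
by rewrite compm_idl.
Qed.

Lemma sbraid_node_l a b c Z :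
  sbraid (Node a b) c Z
  = stackm a (sbraid b c Z) ;; sbraid a c (stack b Z).
Proof.
have := congr1 (fun f => strict (s := Node a (Node b c))
  (t := Node (Node c a) b) f Z) (hexagon_l (ob a) (ob b) (ob c)).
rewrite (strict_comp (t := Node c (Node a b))).
rewrite (strict_comp (t := Node (Node a b) c)).
rewrite strict_assoc_inv strict_assoc_inv compm_idl compm_idr => E.
apply: (etrans E) => {E}.
rewrite (strict_comp (t := Node (Node a c) b)).
rewrite (strict_comp (t := Node a (Node c b))).
rewrite (strict_tens (s' := Node b c) (t' := Node c b)) strict_id compm_idl.
rewrite strict_assoc_inv !compm_idr.
by rewrite (strict_tens (s := Node a c) (t := Node c a)) strict_id stackm_id
  compm_idr.
Qed.

Lemma sbraid_epi a b Z : epi (sbraid a b Z).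
Proof.
have [g [bg gb]] := braid_iso (ob a) (ob b).
apply: (iso_epi (g := strict (s := Node b a) (t := Node a b) g Z)).
by split; rewrite -strict_comp ?bg ?gb strict_id.
Qed.

(* The braiding with the unit object is an idempotent isomorphism. *)
Lemma sbraid_unit_r a Z : sbraid a Unit Z = idm (stack a Z).
Proof.
apply: (@sbraid_epi a Unit Z); rewrite compm_idr.
have := sbraid_nat (s := a) (t := a) (s' := Node Unit Unit) (t' := Unit)
  (idm (ob a)) (lunit unit_obj) Z.
by rewrite sbraid_node_r strict_id !(strict_lunit Unit) stackm_id /= !compm_idl
  !compm_idr.
Qed.

Lemma sbraid_unit_l a Z : sbraid Unit a Z = idm (stack a Z).
Proof.
apply: (@sbraid_epi Unit a Z); rewrite compm_idr.
have := sbraid_nat (s := Node Unit Unit) (t := Unit) (s' := a) (t' := a)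
  (lunit unit_obj) (idm (ob a)) Z.
by rewrite sbraid_node_l strict_id !(strict_lunit Unit) stackm_id /= !compm_idl
  !compm_idr stackm_id compm_idr => <-.
Qed.

Fixpoint under (L : seq tree) (Z : M) : M :=
  if L is t :: L' then under L' (stack t Z) else Z.

Fixpoint underm (L : seq tree) (Z Z' : M) (h : hom Z Z') :
    hom (under L Z) (under L Z') :=
  match L return hom (under L Z) (under L Z') with
  | [::] => h
  | t :: L' => underm L' (stackm t h)
  end.

Lemma underm_id L Z : underm L (idm Z) = idm (under L Z).
Proof. by elim: L Z => //= t L IHL Z; rewrite stackm_id. Qed.

Lemma underm_comp L Z Z' Z'' (h : hom Z Z') (k : hom Z' Z'') :
  underm L (h ;; k) = underm L h ;; underm L k.
Proof. by elim: L Z Z' Z'' h k => //= t L IHL *; rewrite stackm_comp. Qed.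

(* x |-> id_L ⊗ f ⊗ id_Z applied to the generalized element x : P -> L ⊗ s ⊗ Z;
   the list L is read from right to left, so that id_L ⊗ id_X ⊗ h and
   id_(X :: L) ⊗ h are convertible. *)
Definition ap (P : M) (s t : tree) (f : hom (ob s) (ob t)) L Z
    (x : hom P (under L (stack s Z))) : hom P (under L (stack t Z)) :=
  x ;; underm L (strict f Z).

Lemma ap_interchange P s t (f : hom (ob s) (ob t)) s' t'
    (g : hom (ob s') (ob t')) K L Z
    (x : hom P (under L (stack s (under K (stack s' Z))))) :
  ap (s := s) (t := t) f (x ;; underm L (stackm s (underm K (strict g Z))))
  = ap (s := s) (t := t) f x ;; underm L (stackm t (underm K (strict g Z))).
Proof. by rewrite /ap -!compmA -!underm_comp strict_nat. Qed.

(** * Syntax for morphisms and its action on generalized elements *)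

Section Terms.
Variable P : M.
Local Notation elt L Z := (hom P (under L Z)).

(** [cross1] and [cross] compute [sbraid]: the hexagons split it into braidings of single leaves,
    and braidings with the unit object vanish. *)
Fixpoint cross1 X b L Z :
    elt L (X ⊗ stack b Z) -> elt L (stack b (X ⊗ Z)) :=
  match b return elt L (X ⊗ stack b Z) -> elt L (stack b (X ⊗ Z)) with
  | Leaf Y => fun x =>
      ap (s := Node (Leaf X) (Leaf Y)) (t := Node (Leaf Y) (Leaf X))
        (braid X Y) x
  | Unit => fun x => x
  | Node b1 b2 => fun x =>
      @cross1 X b2 (b1 :: L) Z (@cross1 X b1 L (stack b2 Z) x)
  end.

Fixpoint cross a b L Z :
    elt L (stack a (stack b Z)) -> elt L (stack b (stack a Z)) :=
  match a return elt L (stack a (stack b Z)) -> elt L (stack b (stack a Z)) with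
  | Leaf X => @cross1 X b L Z
  | Unit => fun x => x
  | Node a1 a2 => fun x =>
      @cross a1 b L (stack a2 Z) (@cross a2 b (a1 :: L) Z x)
  end.

Lemma crossE a b L Z (x : elt L (stack a (stack b Z))) :
  cross x = x ;; underm L (sbraid a b Z).
Proof.
elim: a L Z x => [X|| a1 IH1 a2 IH2] L Z x /=.
- elim: b L Z x => [Y|| b1 IH1 b2 IH2] L Z x //=.
    by rewrite sbraid_unit_r underm_id compm_idr.
  rewrite IH1 IH2 sbraid_node_r -compmA; congr (_ ;; _).
  exact: esym (underm_comp _ _ _).
- by rewrite sbraid_unit_l underm_id compm_idr.
rewrite IH1 IH2 sbraid_node_l -compmA; congr (_ ;; _).
exact: esym (underm_comp L _ _).
Qed.

Inductive term : tree -> tree -> Type :=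
| Gen s t of hom (ob s) (ob t) : term s t
| Idm s : term s s
| Comp s t u of term s t & term t u : term s u
| Tens s t s' t' of term s t & term s' t' : term (Node s s') (Node t t')
| Assoc a b c : term (Node (Node a b) c) (Node a (Node b c))
| AssocInv a b c : term (Node a (Node b c)) (Node (Node a b) c)
| Lunit a : term (Node Unit a) a
| LunitInv a : term a (Node Unit a)
| Runit a : term (Node a Unit) a
| RunitInv a : term a (Node a Unit)
| Braid a b : term (Node a b) (Node b a).

Fixpoint eval s t (u : term s t) : hom (ob s) (ob t) :=
  match u in term s t return hom (ob s) (ob t) with
  | Gen _ _ f => f
  | Idm s => idm (ob s)
  | Comp _ _ _ u v => eval u ;; eval v
  | Tens _ _ _ _ u v => eval u ⊠ eval v
  | Assoc a b c => assoc (ob a) (ob b) (ob c)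
  | AssocInv a b c => assoc_inv (ob a) (ob b) (ob c)
  | Lunit a => lunit (ob a)
  | LunitInv a => lunit_inv (ob a)
  | Runit a => runit (ob a)
  | RunitInv a => runit_inv (ob a)
  | Braid a b => braid (ob a) (ob b)
  end.

Fixpoint act s t (u : term s t) L Z :
    elt L (stack s Z) -> elt L (stack t Z) :=
  match u in term s t return elt L (stack s Z) -> elt L (stack t Z) with
  | Gen s t f => fun x => ap (s := s) (t := t) f x
  | Idm _ => fun x => x
  | Comp s t u a b => fun x => act b (act a x)
  | Tens s t s' t' a b => fun x =>
      @act _ _ b (t :: L) Z (@act _ _ a L (stack s' Z) x)
  | Assoc _ _ _ => fun x => x
  | AssocInv _ _ _ => fun x => x
  | Lunit _ => fun x => x
  | LunitInv _ => fun x => x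
  | Runit _ => fun x => x
  | RunitInv _ => fun x => x
  | Braid a b => fun x => cross x
  end.

Lemma actE s t (u : term s t) L Z (x : elt L (stack s Z)) :
  act u x = x ;; underm L (strict (eval u) Z).
Proof.
elim: u L Z x => {s t} //=.
- by move=> s L Z x; rewrite strict_id underm_id compm_idr.
- move=> s t u a IHa b IHb L Z x; rewrite IHb IHa strict_comp underm_comp.
  by rewrite -compmA.
- move=> s t s' t' a IHa b IHb L Z x.
  by rewrite IHb IHa strict_tens underm_comp -compmA.
- by move=> a b c L Z x; rewrite strict_assoc underm_id compm_idr.
- by move=> a b c L Z x; rewrite strict_assoc_inv underm_id compm_idr.
- by move=> a L Z x; rewrite strict_lunit underm_id compm_idr.
- by move=> a L Z x; rewrite strict_lunit_inv underm_id compm_idr.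
- by move=> a L Z x; rewrite strict_runit underm_id compm_idr.
- by move=> a L Z x; rewrite strict_runit_inv underm_id compm_idr.
- by move=> a b L Z x; rewrite crossE.
Qed.

Lemma act_eq s t (u v : term s t) L Z (x : elt L (stack s Z)) :
  eval u = eval v -> act u x = act v x.
Proof. by rewrite !actE => ->. Qed.

End Terms.

(** A Yoneda argument: the hypothesis is applied to the identity as generalized element, with empty
    context and trailing unit object. *)
Lemma eval_eq s t (u v : term s t) :
  (forall P L Z (x : hom P (under L (stack s Z))), act u x = act v x) ->
  eval u = eval v.
Proof.
move=> E; apply: strict_faithful.
have := E _ [::] unit_obj (idm _); rewrite !actE /=.
by rewrite !compm_idl.
Qed.

End Strictification.

(** * Reflection into the strictification *)

Ltac reify_ob M X :=
  lazymatch X with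
  | @tens _ ?A ?B =>
      let a := reify_ob M A in
      let b := reify_ob M B in
      constr:(@Node M a b)
  | @unit_obj _ => constr:(@Unit M)
  | _ => constr:(@Leaf M X)
  end.

Ltac reify_hom M s t f :=
  lazymatch f with
  | @braided_mul _ _ =>
      let f' := eval unfold braided_mul in f in reify_hom M s t f'
  | @mid_braid _ _ _ _ _ =>
      let f' := eval unfold mid_braid in f in reify_hom M s t f'
  | @braid_past _ _ _ _ =>
      let f' := eval unfold braid_past in f in reify_hom M s t f'
  | @idm _ _ => constr:(@Idm M s)
  | @compm _ _ ?Y _ ?g ?h =>
      let m := reify_ob M Y in
      let u := reify_hom M s m g in
      let v := reify_hom M m t h in
      constr:(@Comp M s m t u v)
  | @tensm _ _ _ _ _ ?g ?h =>
      lazymatch s with @Node _ ?s1 ?s2 =>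
      lazymatch t with @Node _ ?t1 ?t2 =>
        let u := reify_hom M s1 t1 g in
        let v := reify_hom M s2 t2 h in
        constr:(@Tens M s1 t1 s2 t2 u v)
      end end
  | @assoc _ _ _ _ =>
      lazymatch t with
      | @Node _ ?a (@Node _ ?b ?c) => constr:(@Assoc M a b c)
      end
  | @assoc_inv _ _ _ _ =>
      lazymatch s with
      | @Node _ ?a (@Node _ ?b ?c) => constr:(@AssocInv M a b c)
      end
  | @lunit _ _ => constr:(@Lunit M t)
  | @lunit_inv _ _ => constr:(@LunitInv M s)
  | @runit _ _ => constr:(@Runit M t)
  | @runit_inv _ _ => constr:(@RunitInv M s)
  | @braid _ _ _ =>
      lazymatch s with @Node _ ?a ?b => constr:(@Braid M a b) end
  | _ => constr:(@Gen M s t f)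
  end.

Ltac cat_ctx K L :=
  lazymatch K with
  | @nil _ => L
  | @cons ?T ?k ?K' => let R := cat_ctx K' L in constr:(@cons T k R)
  end.

Ltac push t L :=
  lazymatch t with
  | @Leaf ?M _ => constr:(@cons (tree M) t L)
  | @Unit _ => L
  | @Node _ ?a ?b => let L' := push a L in push b L'
  end.

(** Finds [K] with [L = K ++ S]. Failure means that the two operations are not independent in the
    expected order, and sends the step tactics to another redex. *)
Ltac strip L S :=
  match constr:(Set) with
  | _ => let _ := constr:(ltac:(constr_eq L S; exact I) : True) in
         lazymatch type of L with seq ?T => constr:(@nil T) end
  | _ => lazymatch L with
         | @cons ?T ?k ?L' => let K := strip L' S in constr:(@cons T k K)
         end
  end.

Ltac norm_ctx L :=
  lazymatch L with
  | @cons _ ?t ?L' => let R := norm_ctx L' in push t R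
  | _ => L
  end.

Ltac norm_elt e :=
  lazymatch e with
  | @ap ?M ?P ?s ?t ?f ?L ?Z ?y =>
      let y' := norm_elt y in
      let L' := norm_ctx L in
      let Z' := eval cbn [stack under] in Z in
      constr:(@ap M P s t f L' Z' y')
  | _ => e
  end.

Ltac reify_eq f g k :=
  lazymatch type of f with
  | context [@hom ?C ?X ?Y] =>
      let M := lazymatch C with
        | context [monoidal_abelian (braided_monoidal ?M)] => M
        end in
      let s := reify_ob M X in
      let t := reify_ob M Y in
      let u := reify_hom M s t f in
      let v := reify_hom M s t g in
      k M s t u v
  end.

Ltac norm_goal :=
  lazymatch goal with |- ?a = ?b =>
    let a' := eval cbn [act cross cross1 stack] in a in
    let b' := eval cbn [act cross cross1 stack] in b in
    let a'' := norm_elt a' in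
    let b'' := norm_elt b' in
    change (a'' = b'')
  end.

(* Replaces an equation of morphisms by an equation between functions of a
   generalized element, in which associators and unit constraints are gone and
   braidings of tensor products are split into braidings of their factors. *)
Ltac strictly :=
  lazymatch goal with |- ?f = ?g =>
    reify_eq f g ltac:(fun M s t u v =>
      refine (@eval_eq M s t u v _);
      let P := fresh "P" in let L := fresh "L" in let Z := fresh "Z" in
      let x := fresh "x" in
      intros P L Z x; cbn [stack] in x; norm_goal)
  end.

(* The same for an equation E, as a universally quantified rewrite rule H. *)
Ltac strictify E H :=
  lazymatch type of E with ?f = ?g =>
    reify_eq f g ltac:(fun M s t u v =>
      pose proof (fun P_ L_ Z_ x_ => @act_eq M P_ s t u v L_ Z_ x_ E) as H;
      let T := constr:(forall (P_ : M) (L_ : seq (tree M)) (Z_ : M)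
          (x_ : hom P_ (under L_ (stack s Z_))),
          ltac:(let a := eval cbn [act cross cross1 stack]
                  in (@act M P_ s t u L_ Z_ x_) in
                let b := eval cbn [act cross cross1 stack]
                  in (@act M P_ s t v L_ Z_ x_) in
                let a' := norm_elt a in
                let b' := norm_elt b in
                exact (a' = b'))) in
      let T' := eval cbn [stack] in T in
      change T' in H)
  end.

(* Normalization up to the interchange law: left_step performs the leftmost of
   two independent operations first, right_step the rightmost. *)
Ltac left_step :=
  match goal with
  | |- context [@ap ?M ?P ?s ?t ?f ?L ?Z (@ap _ _ ?s' ?t' ?g ?L' ?Z' ?x)] =>
      let S := push s L in
      let K := strip L' S in
      let T := push t L in
      let L2 := cat_ctx K T in
      let Z2 := eval cbn [under stack] in (under K (stack s' Z')) in
      let E := fresh "E" in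
      pose proof (@ap_interchange M P s t f s' t' g K L Z' x
        : @ap M P s t f L Z (@ap M P s' t' g L' Z' x)
          = @ap M P s' t' g L2 Z' (@ap M P s t f L Z2 x)) as E;
      rewrite E; clear E
  end.

Ltac right_step :=
  match goal with
  | |- context [@ap ?M ?P ?s' ?t' ?g ?L' ?Z' (@ap _ _ ?s ?t ?f ?L ?Z ?x)] =>
      let T := push t L in
      let K := strip L' T in
      let S := push s L in
      let L2 := cat_ctx K S in
      let Z2 := eval cbn [under stack] in (under K (stack t' Z')) in
      let E := fresh "E" in
      pose proof (esym (@ap_interchange M P s t f s' t' g K L Z' x)
        : @ap M P s' t' g L' Z' (@ap M P s t f L Z x)
          = @ap M P s t f L Z2 (@ap M P s' t' g L2 Z' x)) as E;
      rewrite E; clear E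
  end.

Ltac lf := repeat left_step.
Ltac rf := repeat right_step.

Arguments ap {M P s t} f L {Z} x.

(** * Braided tensor products of actions *)

Section BraidedProduct.
Variable M : abelian_braided_category.

(* (x ⊗ x') ⊗ (y ⊗ y') |-> m(x ⊗ _α y) ⊗ m'(^α x' ⊗ y').  It is locked because
   rewriting with compmA would see through the composite. *)
Definition btens (X X' Y Y' V V' : M) (m : hom (X ⊗ Y) V)
    (m' : hom (X' ⊗ Y') V') :
    hom ((X ⊗ X') ⊗ (Y ⊗ Y')) (V ⊗ V') :=
  locked (mid_braid X X' Y Y' ;; (m ⊠ m')).

Lemma btensE (X X' Y Y' V V' : M) (m : hom (X ⊗ Y) V)
    (m' : hom (X' ⊗ Y') V') :
  btens m m' = mid_braid X X' Y Y' ;; (m ⊠ m').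
Proof. by rewrite /btens -lock. Qed.

(* With four different products, this covers modules and bimodules at once. *)
Lemma btens_assoc (X X' Y Y' Z Z' V V' U U' R R' : M)
    (m1 : hom (X ⊗ Y) V) (m2 : hom (V ⊗ Z) R)
    (m3 : hom (Y ⊗ Z) U) (m4 : hom (X ⊗ U) R)
    (m1' : hom (X' ⊗ Y') V') (m2' : hom (V' ⊗ Z') R')
    (m3' : hom (Y' ⊗ Z') U') (m4' : hom (X' ⊗ U') R') :
  (m1 ⊠ idm Z) ;; m2 = assoc X Y Z ;; (idm X ⊠ m3) ;; m4 ->
  (m1' ⊠ idm Z') ;; m2' = assoc X' Y' Z' ;; (idm X' ⊠ m3') ;; m4' ->
  (btens m1 m1' ⊠ idm (Z ⊗ Z')) ;; btens m2 m2'
  = assoc (X ⊗ X') (Y ⊗ Y') (Z ⊗ Z') ;; (idm (X ⊗ X') ⊠ btens m3 m3')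
    ;; btens m4 m4'.
Proof.
move=> E E'; rewrite !btensE.
strictify E H; strictify E' H'.
strictify (braid_nat (idm X') m3) H1; strictify (braid_nat m1' (idm Z)) H2.
by strictly; rewrite H2; lf; rewrite H1 H'; rf; rewrite H; lf.
Qed.

Lemma btens_associator (X X' X'' Y Y' Y'' V V' V'' : M)
    (m : hom (X ⊗ Y) V) (m' : hom (X' ⊗ Y') V') (m'' : hom (X'' ⊗ Y'') V'') :
  btens (btens m m') m'' ;; assoc V V' V''
  = (assoc X X' X'' ⊠ assoc Y Y' Y'') ;; btens m (btens m' m'').
Proof. by rewrite !btensE; strictly; lf. Qed.

Lemma btens_morph (X X' Y Y' V V' U U' T T' R R' : M)
    (m : hom (X ⊗ Y) V) (m' : hom (X' ⊗ Y') V')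
    (k : hom (U ⊗ T) R) (k' : hom (U' ⊗ T') R')
    (f : hom X U) (f' : hom X' U') (g : hom Y T) (g' : hom Y' T')
    (h : hom V R) (h' : hom V' R') :
  m ;; h = (f ⊠ g) ;; k -> m' ;; h' = (f' ⊠ g') ;; k' ->
  btens m m' ;; (h ⊠ h') = ((f ⊠ f') ⊠ (g ⊠ g')) ;; btens k k'.
Proof.
move=> E E'; rewrite !btensE.
strictify E H; strictify E' H'; strictify (braid_nat f' g) H1.
by strictly; lf; rewrite H'; rf; rewrite H; lf; rewrite H1; lf.
Qed.

Lemma btens_unit_r (X X' Y Y' : M) (m : hom (X ⊗ Y) X) (m' : hom (X' ⊗ Y') X')
    (u : hom unit_obj Y) (u' : hom unit_obj Y') :
  (idm X ⊠ u) ;; m = runit X -> (idm X' ⊠ u') ;; m' = runit X' ->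
  (idm (X ⊗ X') ⊠ (lunit_inv unit_obj ;; (u ⊠ u'))) ;; btens m m'
  = runit (X ⊗ X').
Proof.
move=> E E'; rewrite !btensE.
strictify E H; strictify E' H'; strictify (braid_nat (idm X') u) H1.
by strictly; rf; rewrite H1; lf; rewrite H; rewrite H'.
Qed.

Lemma btens_unit_l (X X' Y Y' : M) (m : hom (X ⊗ Y) Y) (m' : hom (X' ⊗ Y') Y')
    (u : hom unit_obj X) (u' : hom unit_obj X') :
  (u ⊠ idm Y) ;; m = lunit Y -> (u' ⊠ idm Y') ;; m' = lunit Y' ->
  ((lunit_inv unit_obj ;; (u ⊠ u')) ⊠ idm (Y ⊗ Y')) ;; btens m m'
  = lunit (Y ⊗ Y').
Proof.
move=> E E'; rewrite !btensE.
strictify E H; strictify E' H'; strictify (braid_nat u' (idm Y)) H1.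
by strictly; rewrite H1; rf; rewrite H; rewrite H'.
Qed.

Lemma btens_counit_r (X X' Y Y' V V' : M) (m : hom (X ⊗ Y) V)
    (m' : hom (X' ⊗ Y') V') (e : hom X' unit_obj) (e' : hom Y' unit_obj)
    (e'' : hom V' unit_obj) :
  m' ;; e'' = (e ⊠ e') ;; lunit unit_obj ->
  btens m m' ;; ((idm V ⊠ e'') ;; runit V)
  = (((idm X ⊠ e) ;; runit X) ⊠ ((idm Y ⊠ e') ;; runit Y)) ;; m.
Proof.
move=> E; rewrite !btensE.
strictify E H; strictify (braid_nat e (idm Y)) H1.
by strictly; lf; rewrite H; rf; rewrite H1; rf.
Qed.

End BraidedProduct.

(** * First order differential calculi *)

Section Calculus.
Variables (M : abelian_braided_category) (A : algebra M) (W : calculus_data A).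
Hypothesis fodcW : is_fodc W.

Lemma diff_ract :
  (diff W ⊠ idm A) ;; ract W = mul A ;; diff W - (idm A ⊠ diff W) ;; lact W.
Proof. by have [_ -> _] := fodcW; rewrite addrK. Qed.

Section LinearMaps.
Variables (A' V : M) (f : hom A A') (l : hom (A' ⊗ V) V).

(** Products a db exhaust [W], so maps that are left linear along [f] are determined by their values
    on differentials. *)
Lemma eq_on_differentials (δ1 δ2 : hom W V) :
  lact W ;; δ1 = (f ⊠ δ1) ;; l -> lact W ;; δ2 = (f ⊠ δ2) ;; l ->
  diff W ;; δ1 = diff W ;; δ2 -> δ1 = δ2.
Proof.
move=> L1 L2 E; have [_ _ ep] := fodcW; apply: ep.
rewrite -!compmA L1 L2 !compmA -!tensm_comp compm_idl.
by rewrite E.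
Qed.

Variables (μ : hom (A' ⊗ A') A') (r : hom (V ⊗ A') V) (D : hom A' V).
Hypotheses (f_mul : mul A ;; f = (f ⊠ f) ;; μ)
  (D_mul : μ ;; D = (D ⊠ idm A') ;; r + (idm A' ⊠ D) ;; l)
  (lr : (l ⊠ idm A') ;; r = assoc A' V A' ;; (idm A' ⊠ r) ;; l).

(* On generators, (a db) c = a d(bc) - ab dc involves only left multiplication
   and d. *)
Lemma right_linear_of_left_linear (δ : hom W V) :
  lact W ;; δ = (f ⊠ δ) ;; l -> diff W ;; δ = f ;; D ->
  ract W ;; δ = (δ ⊠ f) ;; r.
Proof.
move=> δl δd; have [[_ _ lrW] _ ep] := fodcW.
have key : (diff W ⊠ idm A) ;; ract W ;; δ = (f ⊠ f) ;; ((D ⊠ idm A') ;; r).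
  rewrite diff_ract compmBl -!compmA δd δl !compmA f_mul -!compmA D_mul.
  rewrite compmDr !compmA -!tensm_comp compm_idr compm_idl δd.
  by rewrite addrK.
(* Right exactness of the tensor product allows testing on elements (a db) ⊗ c; [key] is the case a
   = 1. *)
apply: (epi_tensl (W := A) ep).
strictify key kE; strictify lrW lrWE; strictify lr lrE; strictify δl δlE.
strictify δd δdE.
strictly; rewrite lrWE δlE; rf.
rewrite kE; lf; rewrite δlE -lrE; lf.
by rewrite δdE; rf; rewrite lrE; lf.
Qed.

Lemma bilinear_of_left_linear (δ : hom W V) :
  lact W ;; δ = (f ⊠ δ) ;; l -> diff W ;; δ = f ;; D ->
  (lact W ⊠ idm A) ;; ract W ;; δ = ((f ⊠ δ) ⊠ f) ;; ((l ⊠ idm A') ;; r).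
Proof.
move=> δl δd; rewrite -compmA right_linear_of_left_linear // !compmA.
by rewrite -!tensm_comp δl compm_idl compm_idr.
Qed.

(** If a db |-> f(a) X(b), then ca db |-> f(ca) X(b) = f(c) f(a) X(b) gives left linearity, and a =
    1 gives the value on differentials. *)
Lemma linear_of_generators (X : hom A V) (δ : hom W V) :
  (μ ⊠ idm V) ;; l = assoc A' A' V ;; (idm A' ⊠ l) ;; l ->
  ((one A ;; f) ⊠ idm V) ;; l = lunit V ->
  (idm A ⊠ diff W) ;; lact W ;; δ = (f ⊠ X) ;; l ->
  lact W ;; δ = (f ⊠ δ) ;; l /\ diff W ;; δ = X.
Proof.
move=> la l1 δp; have [[[la_W l1_W] _ _] _ ep] := fodcW.
strictify la laE; strictify l1 l1E; strictify la_W laW; strictify l1_W l1W.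
strictify δp δpE; strictify f_mul fE; split.
  apply: (epi_tensr (W := A) ep).
  by strictly; rf; rewrite -laW; lf; rewrite δpE; rf; rewrite fE; rf;
     rewrite laE; lf; rewrite δpE; lf.
apply: (iso_epi (lunitP A)).
transitivity ((one A ⊠ idm A) ;; ((idm A ⊠ diff W) ;; lact W ;; δ)).
  by strictly; rf; rewrite l1W.
by rewrite δp; strictly; rf; rewrite l1E.
Qed.

End LinearMaps.

End Calculus.

(** * Covariance reduced to left linearity and values on differentials *)

Section Covariance.
Variables (M : abelian_braided_category) (B : hopf_algebra M).

Lemma Δ_btens : mul B ;; Δ B = (Δ B ⊠ Δ B) ;; btens (mul B) (mul B).
Proof. by rewrite btensE; exact: Δ_mul. Qed.

Section Calculus.
Variable W : calculus_data B.
Hypothesis fodcW : is_fodc W.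

Local Notation ll := (btens (mul B) (lact W)).
Local Notation lr := (btens (mul B) (ract W)).
Local Notation rl := (btens (lact W) (mul B)).
Local Notation rr := (btens (ract W) (mul B)).

(** Serves as the hypothesis [D_mul] with D = id ⊗ d, for maps from [W] to B ⊗ W regarded over B ⊗
    B. *)
Lemma derivation_l :
  btens (mul B) (mul B) ;; (idm B ⊠ diff W)
  = ((idm B ⊠ diff W) ⊠ idm (B ⊗ B)) ;; lr
    + (idm (B ⊗ B) ⊠ (idm B ⊠ diff W)) ;; ll.
Proof.
have [_ leib _] := fodcW.
rewrite [in LHS]btensE -compmA -tensm_comp compm_idr leib tensmDr compmDr.
rewrite -(btensE (mul B) ((diff W ⊠ idm B) ;; ract W)).
rewrite -(btensE (mul B) ((idm B ⊠ diff W) ;; lact W)) -!tensm_id; congr (_ + _).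
  rewrite -(btens_morph (m := mul B) (m' := (diff W ⊠ idm B) ;; ract W)
    (h := idm B) (h' := idm W)) ?tensm_id ?compm_idl ?compm_idr //.
rewrite -(btens_morph (m := mul B) (m' := (idm B ⊠ diff W) ;; lact W)
    (h := idm B) (h' := idm W)) ?tensm_id ?compm_idl ?compm_idr //.
Qed.

Lemma derivation_r :
  btens (mul B) (mul B) ;; (diff W ⊠ idm B)
  = ((diff W ⊠ idm B) ⊠ idm (B ⊗ B)) ;; rr
    + (idm (B ⊗ B) ⊠ (diff W ⊠ idm B)) ;; rl.
Proof.
have [_ leib _] := fodcW.
rewrite [in LHS]btensE -compmA -tensm_comp compm_idr leib tensmDl compmDr.
rewrite -(btensE ((diff W ⊠ idm B) ;; ract W) (mul B)).
rewrite -(btensE ((idm B ⊠ diff W) ;; lact W) (mul B)) -!tensm_id; congr (_ + _).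
  rewrite -(btens_morph (m' := mul B) (m := (diff W ⊠ idm B) ;; ract W)
    (h' := idm B) (h := idm W)) ?tensm_id ?compm_idl ?compm_idr //.
rewrite -(btens_morph (m' := mul B) (m := (idm B ⊠ diff W) ;; lact W)
    (h' := idm B) (h := idm W)) ?tensm_id ?compm_idl ?compm_idr //.
Qed.

Lemma left_covariantI (δ : hom W (B ⊗ W)) :
  is_left_coaction δ -> lact W ;; δ = (Δ B ⊠ δ) ;; ll ->
  diff W ;; δ = Δ B ;; (idm B ⊠ diff W) -> left_covariant δ.
Proof.
move=> co δl δd; split=> //.
have [[_ _ lrW] _ _] := fodcW.
rewrite (bilinear_of_left_linear fodcW Δ_btens derivation_l _ δl δd).
  by rewrite !btensE !compmA.
exact: (btens_assoc (mulA B) lrW).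
Qed.

(** The coaction axioms compare left linear maps, so they are checked on db, where they become
    coassociativity and counitality of Δ. *)
Lemma right_covariantI (δ : hom W (W ⊗ B)) :
  lact W ;; δ = (Δ B ⊠ δ) ;; rl ->
  diff W ;; δ = Δ B ;; (diff W ⊠ idm B) -> right_covariant δ.
Proof.
move=> δl δd; split=> //; last first.
  have [[_ _ lrW] _ _] := fodcW.
  rewrite (bilinear_of_left_linear fodcW Δ_btens derivation_r _ δl δd).
    by rewrite !btensE !compmA.
  exact: (btens_assoc lrW (mulA B)).
split.
- apply: (eq_on_differentials fodcW (f := Δ B ;; (idm B ⊠ Δ B))
    (l := btens (lact W) (btens (mul B) (mul B)))).
  + rewrite !compmA δl -(compmA _ rl).
    rewrite (btens_morph (h := δ) (h' := idm B) δl
      (k' := mul B) (f' := idm B) (g' := idm B)); last first.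
      by rewrite tensm_id compm_idl compm_idr.
    rewrite !compmA -(compmA _ (btens _ _) (assoc _ _ _)) btens_associator compmA.
    by rewrite -!tensm_comp ΔA.
  + rewrite !compmA δl -(compmA _ rl).
    rewrite (btens_morph (h := idm W) (h' := Δ B) (k := lact W) (f := idm B)
      (g := idm W) _ Δ_btens); last by rewrite tensm_id compm_idl compm_idr.
    by rewrite !compmA -!tensm_comp.
  + rewrite !compmA δd -(compmA _ _ (idm W ⊠ Δ B)) -tensm_comp compm_idr.
    rewrite compm_idl -(compmA _ _ (δ ⊠ idm B)) -tensm_comp compm_idr δd.
    have E := ΔA B; strictify E H; strictly.
    by rewrite H; lf.
- rewrite -compmA; apply: (eq_on_differentials fodcW (f := idm B) (l := lact W)).
  + rewrite compmA δl -compmA (btens_counit_r _ (ε_mul B)) compmA -tensm_comp.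
    by rewrite compmA Δ_counitr.
  + by rewrite tensm_id compm_idl compm_idr.
  rewrite compmA δd compm_idr.
  have E := Δ_counitr B; strictify E H; strictly.
  by rf; rewrite H.
Qed.

(** Bilinearity at c = 1, using Δ(1) = 1 ⊗ 1. *)
Lemma left_covariant_lact (δ : hom W (B ⊗ W)) :
  left_covariant δ -> lact W ;; δ = (Δ B ⊠ δ) ;; ll.
Proof.
case=> _ _ bil _; have [[_ [_ r1] _] _ _] := fodcW.
apply: (iso_epi (runitP (B ⊗ W))); strictify r1 R.
transitivity ((idm (B ⊗ W) ⊠ one B) ;; ((lact W ⊠ idm B) ;; ract W ;; δ)).
  by strictly; lf; rewrite R.
rewrite bil -(compmA _ (mid_braid _ _ _ _) (mul B ⊠ ract W)) -!btensE.
rewrite !compmA -!tensm_comp !compm_idl compm_idr Δ_one tens_lr -compmA.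
by rewrite (btens_unit_r (mul1r B) r1) runit_nat compmA.
Qed.

Lemma right_covariant_lact (δ : hom W (W ⊗ B)) :
  right_covariant δ -> lact W ;; δ = (Δ B ⊠ δ) ;; rl.
Proof.
case=> _ _ bil _; have [[_ [_ r1] _] _ _] := fodcW.
apply: (iso_epi (runitP (B ⊗ W))); strictify r1 R.
transitivity ((idm (B ⊗ W) ⊠ one B) ;; ((lact W ⊠ idm B) ;; ract W ;; δ)).
  by strictly; lf; rewrite R.
rewrite bil -(compmA _ (mid_braid _ _ _ _) (ract W ⊠ mul B)) -!btensE.
rewrite !compmA -!tensm_comp !compm_idl compm_idr Δ_one tens_lr -compmA.
by rewrite (btens_unit_r r1 (mul1r B)) runit_nat compmA.
Qed.

End Calculus.
End Covariance.

(** * The calculus of a right ideal *)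

Section Augmentation.
Variables (M : abelian_braided_category) (B : hopf_algebra M).

Lemma aug_inc_counit : aug_inc B ;; ε B = 0.
Proof. by have [] := ker_incP (ε B). Qed.

Lemma aug_inc_mono : mono (aug_inc B).
Proof. exact: kernel_mono (ker_incP _). Qed.

Lemma one_aug_proj : one B ;; aug_proj B = 0.
Proof.
apply: aug_inc_mono.
rewrite -compmA aug_projE compmBr compm_idr compmA ε_one compm_idl subrr.
by rewrite comp0m.
Qed.

Lemma aug_factor Z (g : hom Z B) :
  g ;; ε B = 0 -> g = g ;; aug_proj B ;; aug_inc B.
Proof.
by move=> g0; rewrite -compmA aug_projE compmBr compm_idr compmA g0 comp0m subr0.
Qed.

Lemma aug_mul_counit : (aug_inc B ⊠ idm B) ;; mul B ;; ε B = 0.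
Proof.
rewrite -compmA ε_mul compmA -tensm_comp aug_inc_counit.
by rewrite tens0m comp0m.
Qed.

End Augmentation.

Section IdealCalculus.
Variables (M : abelian_braided_category) (B : hopf_algebra M).
Variable I : right_ideal B.

Local Notation Q := (quot I).
Local Notation cls := (cls I).
Local Notation qact := (quot_act I).

Lemma quot_pr_epi : epi (quot_pr I).
Proof. exact: cokernel_epi (coker_prP _). Qed.

Lemma aug_inc_cls : aug_inc B ;; cls = quot_pr I.
Proof. by rewrite /Defs.cls compmA aug_incK compm_idl. Qed.

Lemma one_cls : one B ;; cls = 0.
Proof. by rewrite /Defs.cls compmA one_aug_proj comp0m. Qed.

Lemma cls_epi : epi cls.
Proof.
apply: (epi_comp (f := aug_inc B)); rewrite aug_inc_cls.
exact: quot_pr_epi.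
Qed.

Lemma quot_actE :
  (quot_pr I ⊠ idm B) ;; qact = (aug_inc B ⊠ idm B) ;; mul B ;; cls.
Proof. exact/eqP/(xchooseP (quot_act_ex I)). Qed.

(** The extended bracket is [b - ε(b) 1], and (b - ε(b) 1) c = bc - ε(b) c. The correction term is
    what yields the Leibniz rule. *)
Lemma cls_act : (cls ⊠ idm B) ;; qact = mul B ;; cls - (ε B ⊠ cls) ;; lunit Q.
Proof.
rewrite {1}/Defs.cls tens_comp_l -compmA quot_actE !compmA -tensm_comp aug_projE.
rewrite compm_idl tensmBl tensm_id !compmBl compm_idl; congr (_ - _).
rewrite tens_comp_l -(compmA _ _ (mul B)) mul1l.
rewrite -!compmA -[_ ;; quot_pr I]/cls -lunit_nat compmA.
by rewrite -tensm_comp compm_idl compm_idr.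
Qed.

Lemma quot_actA :
  (qact ⊠ idm B) ;; qact = assoc Q B B ;; (idm Q ⊠ mul B) ;; qact.
Proof.
(* The action is lifted to a map [t] from B⁺ ⊗ B to B⁺, which inherits associativity from B; the
   result then descends along [quot_pr]. *)
have E0 := quot_actE; rewrite (aug_factor (aug_mul_counit B)) in E0.
rewrite -(compmA _ (aug_inc B)) aug_inc_cls in E0.
set t := (aug_inc B ⊠ idm B) ;; mul B ;; aug_proj B in E0.
have tE : t ;; aug_inc B = (aug_inc B ⊠ idm B) ;; mul B.
  by rewrite /t -(aug_factor (aug_mul_counit B)).
have tA : (t ⊠ idm B) ;; t
    = assoc (aug B) B B ;; (idm (aug B) ⊠ mul B) ;; t.
  apply: aug_inc_mono; strictify tE H; strictify (mulA B) H1.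
  by strictly; rewrite !H H1; lf.
clearbody t; apply: (epi_tensl (W := B) (epi_tensl (W := B) quot_pr_epi)).
strictify E0 H; strictify tA H1.
by strictly; rewrite H; rf; rewrite !H H1.
Qed.

Lemma quot_act1 : (idm Q ⊠ one B) ;; qact = runit Q.
Proof.
apply: (epi_tensl (W := unit_obj) quot_pr_epi).
strictify quot_actE H; strictify (mul1r B) H1; strictify aug_inc_cls H2.
by strictly; rf; rewrite H; lf; rewrite H1 H2.
Qed.

(** The term b ⊗ 1 disappears since [1] = 0. *)
Lemma diff_ideal : diff (ideal_calculus I) = Δ B ;; (idm B ⊠ cls).
Proof.
rewrite /= compmBl -(compmA (runit_inv B)) -tensm_comp one_cls.
by rewrite tensm0 compm0 subr0.
Qed.

Lemma ract_ideal :
  ract (ideal_calculus I) = (idm (B ⊗ Q) ⊠ Δ B) ;; btens (mul B) qact.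
Proof. by rewrite btensE compmA. Qed.

(* a ⊗ b |-> a b¹ ⊗ b² *)
Definition galois : hom (B ⊗ B) (B ⊗ B) :=
  (idm B ⊠ Δ B) ;; assoc_inv B B B ;; (mul B ⊠ idm B).

Definition galois_inv : hom (B ⊗ B) (B ⊗ B) :=
  (idm B ⊠ (Δ B ;; (antipode B ⊠ idm B))) ;; assoc_inv B B B ;; (mul B ⊠ idm B).

(** Coassociativity and the antipode axioms give a b¹ S(b²) ⊗ b³ = a ⊗ b = a S(b¹) b² ⊗ b³. *)
Lemma galoisP : is_inverse galois galois_inv.
Proof.
strictify (ΔA B) dA; strictify (mulA B) mA.
strictify (antipodel B) sl; strictify (antipoder B) sr.
strictify (Δ_counitl B) cl; strictify (mul1r B) m1.
split; rewrite /galois /galois_inv; strictly.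
  by rf; rewrite mA -dA sr m1 cl.
by rf; rewrite mA -dA sl m1 cl.
Qed.

Local Notation Ω := (ideal_calculus I).

Lemma ideal_generators : (idm B ⊠ diff Ω) ;; lact Ω = galois ;; (idm B ⊠ cls).
Proof.
rewrite diff_ideal /galois; cbn [forms lact ideal_calculus]; strictly.
by rf.
Qed.

(** The right action is the braided product action of B ⊗ B on B ⊗ (B⁺/I), restricted along the
    algebra map Δ. *)
Lemma ideal_bimodule : is_bimodule Ω.
Proof.
have E := btens_unit_r (mul1r B) quot_act1.
have EA := btens_assoc (mulA B) quot_actA.
rewrite /is_bimodule ract_ideal; cbn [forms lact ideal_calculus].
strictify (mulA B) mA; strictify (mul1l B) m1; strictify EA qA.
strictify (Δ_btens B) dm.
strictify (Δ_one B) d1; strictify E q1.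
split; [split | split |].
- by strictly; rewrite -mA; lf.
- by strictly; rewrite m1.
- by strictly; rewrite dm; rf; rewrite -qA; lf.
- by strictly; rewrite d1 q1.
- by rewrite btensE; strictly; lf; rewrite -mA; lf.
Qed.

(** Both terms on the right are braided products of Δ(b) and Δ(c). By [cls_act] the first
    contributes [b² c²] - ε(b²) [c²] in the second leg, up to braiding, and b dc cancels the
    correction. *)
Lemma ideal_leibniz :
  mul B ;; diff Ω = (diff Ω ⊠ idm B) ;; ract Ω + (idm B ⊠ diff Ω) ;; lact Ω.
Proof.
have -> : (diff Ω ⊠ idm B) ;; ract Ω
  = (Δ B ⊠ Δ B) ;; btens (mul B) ((cls ⊠ idm B) ;; qact).
  rewrite ract_ideal diff_ideal !btensE.
  cbn [forms ideal_calculus]; strictify (braid_nat cls (idm B)) H; strictly.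
  by rf; rewrite H; lf.
have -> : (idm B ⊠ diff Ω) ;; lact Ω
  = (Δ B ⊠ Δ B) ;; btens (mul B) ((ε B ⊠ cls) ;; lunit Q).
  rewrite diff_ideal !btensE; cbn [forms lact ideal_calculus].
  strictify (braid_nat (ε B) (idm B)) H; strictify (Δ_counitr B) H1.
  by strictly; rf; rewrite -H; lf; rewrite H1; lf.
rewrite diff_ideal compmA Δ_btens cls_act !btensE tensmBr compmBr compmBr subrK.
by rewrite -!compmA -tensm_comp compm_idr.
Qed.

Lemma ideal_fodc : is_fodc Ω.
Proof.
split; [exact: ideal_bimodule | exact: ideal_leibniz |].
rewrite ideal_generators; apply: comp_epi (iso_epi galoisP) _.
exact: (epi_tensr (W := B) cls_epi).
Qed.

Lemma ideal_left_covariant : left_covariant (ideal_lcoact I).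
Proof.
apply: (left_covariantI ideal_fodc); rewrite /ideal_lcoact.
- strictify (ΔA B) dA; strictify (Δ_counitl B) c1.
  by split; cbn [forms ideal_calculus]; strictly; rewrite ?dA ?c1; lf.
- rewrite btensE; cbn [forms lact ideal_calculus].
  by strictify (Δ_mul B) dm; strictly; rewrite dm; lf.
rewrite diff_ideal; strictify (ΔA B) dA; cbn [forms ideal_calculus].
by strictly; lf; rewrite dA; lf.
Qed.

(* rcoact_formula without the restriction to B ⊗ B⁺. *)
Definition rcoact_lift : hom (B ⊗ B) ((B ⊗ Q) ⊗ B) :=
  (Δ B ⊠ (Δ B ;; (idm B ⊠ Δ B)))
  ;; (idm (B ⊗ B) ⊠ (antipode B ⊠ (cls ⊠ idm B)))
  ;; assoc B B (B ⊗ (Q ⊗ B))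
  ;; (idm B ⊠ (assoc_inv B B (Q ⊗ B)
               ;; (mul B ⊠ idm (Q ⊗ B)) ;; braid_past B Q B ;; (idm Q ⊠ mul B)))
  ;; assoc_inv B Q B.

Lemma rcoact_formulaE : rcoact_formula I = (idm B ⊠ aug_inc B) ;; rcoact_lift.
Proof.
by rewrite /rcoact_formula /rcoact_lift; strictly; lf.
Qed.

(* a ⊗ b |-> Δ(a) · (d b¹ ⊗ b²) *)
Lemma galois_rcoact_lift :
  galois ;; rcoact_lift
  = (Δ B ⊠ (Δ B ;; (diff Ω ⊠ idm B))) ;; btens (lact Ω) (mul B).
Proof.
rewrite diff_ideal /galois /rcoact_lift btensE.
cbn [forms lact ideal_calculus].
strictify (ΔA B) dA; strictify (mulA B) mA.
strictify (Δ_mul B) dm.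
strictify (antipoder B) sr; strictify (Δ_counitl B) cl; strictify (mul1r B) m1.
strictly; rf; rewrite dm; rf; rewrite mA; lf; rewrite dA; lf; rewrite -dA; rf.
by rewrite sr; lf; rewrite cl m1.
Qed.

(* a ⊗ ([c] ⊗ e) |-> a¹ ⊗ _α[c] ⊗ ^α(a²) e *)
Definition corner : hom (B ⊗ (Q ⊗ B)) ((B ⊗ Q) ⊗ B) :=
  (Δ B ⊠ idm (Q ⊗ B)) ;; assoc B B (Q ⊗ B)
  ;; (idm B ⊠ (braid_past B Q B ;; (idm Q ⊠ mul B))) ;; assoc_inv B Q B.

(** The factors of a² S(b¹) may cross [b²] one after the other. Crossing S(b¹) first produces the
    adjoint coaction, which ties descent of the formula to stability of I. *)
Lemma rcoact_lift_coAdR :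
  rcoact_lift = (idm B ⊠ (coAdR B ;; (cls ⊠ idm B))) ;; corner.
Proof.
rewrite /corner /rcoact_lift /coAdR.
strictify (braid_nat (mul B) (idm Q)) s1.
strictify (braid_nat (antipode B) (idm Q)) s2.
strictify (braid_nat (idm B) cls) s3; strictify (mulA B) mA.
by strictly; rf; rewrite s1; lf; rewrite mA -s3; rf; rewrite -s2; lf.
Qed.

Lemma one_diff_ideal : one B ;; diff Ω = 0.
Proof.
rewrite diff_ideal compmA Δ_one -compmA -tensm_comp one_cls.
by rewrite tensm0 compm0.
Qed.

Lemma galois_one : (idm B ⊠ one B) ;; galois = idm B ⊠ one B.
Proof.
rewrite /galois; strictify (Δ_one B) d1; strictify (mul1r B) m1.
by strictly; rewrite d1; lf; rewrite m1.
Qed.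

(** Through the Galois map, a ⊗ 1 goes to Δ(a) · (d1 ⊗ 1) = 0. Hence the formula on B ⊗ B⁺
    determines its extension to B ⊗ B. *)
Lemma rcoact_lift_one : (idm B ⊠ one B) ;; rcoact_lift = 0.
Proof.
rewrite -galois_one -compmA galois_rcoact_lift compmA -tensm_comp.
rewrite (compmA (one B)) Δ_one -(compmA (lunit_inv _)) -tensm_comp.
by rewrite one_diff_ideal tens0m compm0 tensm0 comp0m.
Qed.

(** Covariance forces a db |-> Δ(a) · (d b¹ ⊗ b²), and invertibility of the Galois map turns this
    into the closed formula. *)
Lemma right_covariant_lift (δ : hom Ω (Ω ⊗ B)) :
  right_covariant δ -> (idm B ⊠ cls) ;; δ = rcoact_lift.
Proof.
move=> cov; have [_ _ _ δd] := cov.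
apply: (iso_epi galoisP).
rewrite galois_rcoact_lift compmA -ideal_generators -compmA.
rewrite (right_covariant_lact ideal_fodc cov) compmA -tensm_comp.
by rewrite compm_idl δd.
Qed.

Lemma lift_right_covariant (δ : hom Ω (Ω ⊗ B)) :
  (idm B ⊠ cls) ;; δ = rcoact_lift -> right_covariant δ.
Proof.
move=> δE; have [[la l1] _ _] := ideal_bimodule.
have gen : (idm B ⊠ diff Ω) ;; lact Ω ;; δ
    = (Δ B ⊠ (Δ B ;; (diff Ω ⊠ idm B))) ;; btens (lact Ω) (mul B).
  by rewrite ideal_generators -compmA δE galois_rcoact_lift.
have la' := btens_assoc la (mulA B).
have l1' := btens_unit_l l1 (mul1l B); rewrite -Δ_one in l1'.
have [δl δd] := linear_of_generators ideal_fodc (Δ_btens B) la' l1' gen.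
exact: (right_covariantI ideal_fodc δl δd).
Qed.

Lemma rcoact_formula_lift (δ : hom Ω (Ω ⊗ B)) :
  is_ideal_rcoact δ <-> (idm B ⊠ cls) ;; δ = rcoact_lift.
Proof.
rewrite /is_ideal_rcoact rcoact_formulaE; split=> E; last first.
  by rewrite -E compmA -tens_comp_r aug_inc_cls.
rewrite [X in _ ⊠ X]/Defs.cls tens_comp_r -compmA E compmA -tens_comp_r aug_projE.
rewrite tensmBr compmBl tensm_id compm_idl tens_comp_r -compmA.
by rewrite rcoact_lift_one compm0 subr0.
Qed.

(** By right exactness B ⊗ (B⁺/I) is the cokernel of B ⊗ I -> B ⊗ B⁺, so the formula descends once
    it vanishes on B ⊗ I. *)
Lemma ideal_rcoact_ex :
  (idm B ⊠ (ideal_inc I ;; aug_inc B)) ;; rcoact_lift = 0 ->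
  exists δ : hom Ω (Ω ⊗ B), is_ideal_rcoact δ.
Proof.
have [_ cokU] := tens_cokerr B (coker_prP (ideal_inc I)).
rewrite tens_comp_r -compmA => /cokU [δ [δE _]].
by exists δ; rewrite /is_ideal_rcoact rcoact_formulaE.
Qed.

End IdealCalculus.

(** * Images, and stability of the ideal under the adjoint coaction *)

Section LandsIn.
Variables (M : abelian_braided_category).

Lemma lands_inP (X Y Z : M) (f : hom X Z) (g : hom Y Z) :
  lands_in f g <-> f ;; coker_pr g = 0.
Proof.
have [k0 kU] := ker_incP (coker_pr g).
split=> [[h <-]|/kU [h [hE _]]]; last by exists h.
by rewrite -compmA k0 compm0.
Qed.

Lemma lands_in_zero (X Y Z V : M) (f : hom X Z) (g : hom Y Z) (h : hom Z V) :
  lands_in f g -> g ;; h = 0 -> f ;; h = 0.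
Proof.
have [_ cU] := coker_prP g.
by move=> /lands_inP f0 /cU [k [<- _]]; rewrite compmA f0 comp0m.
Qed.

End LandsIn.

Section Stability.
Variables (M : abelian_braided_category) (B : hopf_algebra M).
Variable I : right_ideal B.

Lemma ideal_inc_cls : ideal_inc I ;; aug_inc B ;; cls I = 0.
Proof. by rewrite -compmA aug_inc_cls; have [] := coker_prP (ideal_inc I). Qed.

Lemma coAdR_counit : coAdR B ;; (ε B ⊠ idm B) ;; lunit B = ε B ;; one B.
Proof.
rewrite /coAdR.
strictify (antipodel B) sl; strictify (braid_nat (idm B) (ε B)) s1.
strictify (Δ_counitl B) cl.
by strictly; lf; rewrite -s1 cl sl; lf.
Qed.

(** At a = 1, [corner] sends [c] ⊗ e to 1 ⊗ [c] ⊗ e, and the counit undoes this. So vanishing of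
    [rcoact_lift] on B ⊗ I can be read back as a condition on [coAdR]. *)
Lemma corner_retraction :
  exists r : hom ((B ⊗ quot I) ⊗ B) (quot I ⊗ B),
  lunit_inv (quot I ⊗ B) ;; (one B ⊠ idm (quot I ⊗ B)) ;; corner I ;; r = idm _.
Proof.
exists ((((ε B ⊠ idm (quot I)) ;; lunit (quot I)) ⊠ idm B)).
rewrite /corner; strictify (Δ_one B) d1; strictify (ε_one B) e1.
strictify (mul1l B) m1; strictify (braid_nat (one B) (idm (quot I))) s1.
by strictly; rewrite d1; lf; rewrite e1 s1 m1.
Qed.

(** Landing in the image of I ⊗ B means vanishing in (B/I) ⊗ B, by right exactness. Modulo I, b is
    determined by [b] and ε(b), so for the converse it suffices to apply the bracket ([v1]) and ε
    ([v2]) to the first leg. *)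
Lemma coAdR_stableP :
  coAdR_stable I <->
  (idm B ⊠ (ideal_inc I ;; aug_inc B)) ;; rcoact_lift I = 0.
Proof.
rewrite /coAdR_stable; set j := ideal_inc I ;; aug_inc B.
have jc : j ;; cls I = 0 by exact: ideal_inc_cls.
have jε : j ;; ε B = 0 by rewrite /j -compmA aug_inc_counit compm0.
rewrite rcoact_lift_coAdR compmA -tens_comp_r; split=> [st|van].
  rewrite compmA (lands_in_zero st) ?tensm0 ?comp0m //.
  by rewrite -tens_comp_l jc tens0m.
have v1 : j ;; coAdR B ;; (cls I ⊠ idm B) = 0.
  have [r rE] := corner_retraction.
  have E : lunit_inv _ ;; (one B ⊠ idm _) ;;
      ((idm B ⊠ (j ;; (coAdR B ;; (cls I ⊠ idm B)))) ;; corner I) ;; r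
      = j ;; coAdR B ;; (cls I ⊠ idm B).
    rewrite -[RHS]compm_idr -rE !compmA; congr (_ ;; _ ;; _).
    by strictly; lf.
  by rewrite -E van compm0 comp0m.
have v2 : j ;; coAdR B ;; (ε B ⊠ idm B) = 0.
  have [l1 _] := lunitP B.
  rewrite -[LHS]compm_idr -l1 compmA -(compmA _ _ (lunit B)) -(compmA j).
  by rewrite (compmA (coAdR B)) coAdR_counit compmA jε !comp0m.
apply/lands_inP.
have [_ cU] := tens_cokerl B (coker_prP j).
have [c0 _] := coker_prP (j ⊠ idm B); have [h [<- _]] := cU _ _ c0.
have [jc0 _] := coker_prP j; set c := coker_pr j in jc0 *.
(* The map [u] from B⁺/I to B/I is induced by the inclusion of B⁺; the splitting b = (b - ε(b) 1) +
   ε(b) 1 then decomposes the projection [c]. *)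
have [_ qU] := coker_prP (ideal_inc I).
have [u [uE _]] : exists! u, quot_pr I ;; u = aug_inc B ;; c.
  by apply: qU; rewrite compmA.
have -> : c = cls I ;; u + ε B ;; (one B ;; c).
  rewrite /cls -compmA uE compmA aug_projE compmBl compm_idl -compmA.
  by rewrite subrK.
rewrite compmA tensmDl compmDr (tens_comp_l _ (cls I) u) (tens_comp_l _ (ε B)).
rewrite (compmA _ _ (u ⊠ _)) (compmA _ (ε B ⊠ _)) v1 v2 !comp0m.
by rewrite addr0 comp0m.
Qed.

Lemma ideal_bicovariant :
  coAdR_stable I ->
  exists δ : hom (ideal_calculus I) (ideal_calculus I ⊗ B),
    is_ideal_rcoact δ /\ bicovariant (ideal_lcoact I) δ.
Proof.
move=> /coAdR_stableP /ideal_rcoact_ex [δ δE]; exists δ; split=> //.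
split; first exact: ideal_left_covariant.
exact/lift_right_covariant/rcoact_formula_lift.
Qed.

End Stability.

(** * The structure theorem *)

Section Coimage.
Variable C : abelian_category.

(** Suppose g ;; e = 0 and let c be the cokernel of g. The epimorphism q ;; c is a cokernel of some
    k, which kills f and hence q. So q factors through q ;; c, which makes c split mono and g =
    0. *)
Lemma coimage_mono (X Y : C) (f : hom X Y) (e : hom (coker_obj (ker_inc f)) Y) :
  coker_pr (ker_inc f) ;; e = f -> mono e.
Proof.
set q := coker_pr _ => qe; have [iq qU] := coker_prP (ker_inc f).
have q_epi : epi q := cokernel_epi (coker_prP _).
suff mono0 Z (g : hom Z _) : g ;; e = 0 -> g = 0.
  move=> Z g h E; apply/eqP; rewrite -subr_eq0; apply/eqP/mono0.
  by rewrite compmBl E subrr.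
move=> ge0; have [gc cU] := coker_prP g; set c := coker_pr g in gc cU.
have c_epi : epi c := cokernel_epi (coker_prP g).
have [K [k [kqc qcU]]] := epi_is_cokernel (comp_epi q_epi c_epi).
have [e' [e'E _]] := cU _ _ ge0.
have kf : k ;; f = 0 by rewrite -qe -e'E (compmA q) compmA kqc comp0m.
have [_ kerU] := ker_incP f; have [k' [k'E _]] := kerU _ _ kf.
have kq : k ;; q = 0 by rewrite -k'E -compmA iq compm0.
have [s [sE _]] := qcU _ _ kq.
have cs : c ;; s = idm _ by apply: q_epi; rewrite compmA sE compm_idr.
by rewrite -[g]compm_idr -cs compmA gc comp0m.
Qed.

End Coimage.

Section Structure.
Variables (M : abelian_braided_category) (B : hopf_algebra M).
Variable W : calculus_data B.

(* The Maurer-Cartan form b |-> S(b¹) d b². *)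
Definition mc : hom B W := Δ B ;; (antipode B ⊠ diff W) ;; lact W.

Definition mc_span : hom (B ⊗ B) W := (idm B ⊠ mc) ;; lact W.

Hypothesis fodcW : is_fodc W.

Lemma lactA : (mul B ⊠ idm W) ;; lact W
  = assoc B B W ;; (idm B ⊠ lact W) ;; lact W.
Proof. by have [[[-> _] _ _] _ _] := fodcW. Qed.

Lemma lact1 : (one B ⊠ idm W) ;; lact W = lunit W.
Proof. by have [[[_ ->] _ _] _ _] := fodcW. Qed.

Lemma one_diff : one B ;; diff W = 0.
Proof.
have [[_ [_ r1] _] _ _] := fodcW.
have E := congr1 (fun u => (one B ⊠ one B) ;; u) (diff_ract fodcW).
apply: (iso_epi (lunitP unit_obj)); rewrite compm0.
have E1 : (one B ⊠ one B) ;; ((diff W ⊠ idm B) ;; ract W)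
    = lunit unit_obj ;; (one B ;; diff W).
  by strictify r1 H; strictly; lf; rewrite H.
have E2 : (one B ⊠ one B) ;; (mul B ;; diff W)
    = lunit unit_obj ;; (one B ;; diff W).
  by strictify (mul1l B) H; strictly; rf; rewrite H.
have E3 : (one B ⊠ one B) ;; ((idm B ⊠ diff W) ;; lact W)
    = lunit unit_obj ;; (one B ;; diff W).
  by strictify lact1 H; strictly; rf; rewrite H.
by rewrite compmBr E1 E2 E3 subrr in E.
Qed.

Lemma one_mc : one B ;; mc = 0.
Proof.
rewrite /mc !compmA Δ_one -(compmA (lunit_inv _)) -tensm_comp.
by rewrite one_diff tensm0 compm0 comp0m.
Qed.

(** Here a b¹ ϖ(b²) = a b¹ S(b²) d b³ collapses to a db. Surjectivity of [mc_span] and db = b¹ ϖ(b²)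
    both follow. *)
Lemma galois_mc_span : galois B ;; mc_span = (idm B ⊠ diff W) ;; lact W.
Proof.
rewrite /galois /mc_span /mc.
strictify (ΔA B) dA; strictify lactA la; strictify lact1 l1.
strictify (antipoder B) sr; strictify (Δ_counitl B) cl.
strictly; rf; rewrite la; rf; rewrite -(la _ (Leaf B :: _)); lf.
by rewrite -dA sr; lf; rewrite cl; rf; rewrite l1.
Qed.

Lemma mc_span_epi : epi mc_span.
Proof.
have [_ _ ep] := fodcW; rewrite -galois_mc_span in ep.
exact: epi_comp ep.
Qed.

Lemma diff_mc : diff W = Δ B ;; (idm B ⊠ mc) ;; lact W.
Proof.
apply: (iso_epi (lunitP B)).
transitivity ((one B ⊠ idm B) ;; ((idm B ⊠ diff W) ;; lact W)).
  by strictify lact1 H; strictly; rf; rewrite H.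
rewrite -galois_mc_span /galois /mc_span; strictify (mul1l B) H.
by strictly; rf; rewrite H.
Qed.

(* ϖ(b) c + ε(b) dc = _α(c¹) ϖ(^αb c²) *)
Lemma mc_ract :
  (mc ⊠ idm B) ;; ract W + (ε B ⊠ diff W) ;; lunit W
  = (idm B ⊠ Δ B) ;; braid_past B B B ;; (idm B ⊠ (mul B ;; mc)) ;; lact W.
Proof.
have [[_ _ lr] _ _] := fodcW.
have E1 : (mc ⊠ idm B) ;; ract W
    = (Δ B ⊠ idm B) ;; assoc B B B
      ;; (antipode B ⊠ ((diff W ⊠ idm B) ;; ract W)) ;; lact W.
  by strictify lr H; rewrite /mc; strictly; lf; rewrite H; lf.
have E2 : (ε B ⊠ diff W) ;; lunit W
    = (Δ B ⊠ idm B) ;; assoc B B B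
      ;; (antipode B ⊠ ((idm B ⊠ diff W) ;; lact W)) ;; lact W.
  strictify lactA la; strictify lact1 l1; strictify (antipodel B) sl.
  by strictly; lf; rewrite -la; lf; rewrite sl; rf; rewrite l1.
(* By the Leibniz rule the two terms add up to S(b¹) d(b² c); after expanding d by [diff_mc], S(b¹)
   cancels. *)
rewrite E1 E2 diff_ract // tensmBr compmBr compmBl subrK.
rewrite diff_mc; strictify (ΔA B) dA; strictify (mulA B) mA.
strictify lactA la; strictify (antipodel B) sl; strictify (Δ_mul B) dm.
strictify (Δ_counitl B) cl; strictify (mul1l B) m1.
strictly; rewrite dm; lf; rewrite -la; lf; rewrite -mA.
by rf; rewrite -dA; lf; rewrite sl; lf; rewrite cl; rf; rewrite m1.
Qed.

(* ϖ(bc) = _αS(c¹) ϖ(^αb) c² + ε(b) ϖ(c).  Deriving it from mc_ract avoids the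
   anti-multiplicativity of the antipode. *)
Lemma mul_mc :
  mul B ;; mc
  = (idm B ⊠ Δ B) ;; braid_past B B B
      ;; (antipode B ⊠ ((mc ⊠ idm B) ;; ract W)) ;; lact W
    + (ε B ⊠ mc) ;; lunit W.
Proof.
have -> : (ε B ⊠ mc) ;; lunit W
    = (idm B ⊠ Δ B) ;; braid_past B B B
      ;; (antipode B ⊠ ((ε B ⊠ diff W) ;; lunit W)) ;; lact W.
  rewrite /mc; strictify (braid_nat (ε B) (idm B)) s1.
  by strictly; rf; rewrite -s1; lf.
(* The terms merge so that [mc_ract] applies to ^αb and c²; then S(c¹) cancels. *)
rewrite -compmDl -compmDr -tensmDr mc_ract.
strictify (ΔA B) dA.
strictify lactA la; strictify lact1 l1; strictify (antipodel B) sl.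
strictify (Δ_counitl B) cl; strictify (braid_nat (idm B) (Δ B)) s1.
strictify (braid_nat (idm B) (ε B)) s3.
strictly; lf; rewrite -la; rf; rewrite -dA s1; lf; rewrite sl; lf.
by rewrite -s3 cl; rf; rewrite l1.
Qed.

Section LeftCovariant.
Variable δ : hom W (B ⊗ W).
Hypothesis covδ : left_covariant δ.

(** Left coinvariance of ϖ; the Galois map reduces it to elements a db. *)
Lemma mc_span_coact :
  mc_span ;; δ = (Δ B ⊠ idm B) ;; assoc B B B ;; (idm B ⊠ mc_span).
Proof.
have [_ _ _ δd] := covδ.
apply: (iso_epi (galoisP B)); rewrite compmA galois_mc_span -compmA.
rewrite (left_covariant_lact fodcW covδ) compmA -tensm_comp compm_idl δd.
have E := galois_mc_span; rewrite /mc_span in E *.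
rewrite /galois btensE in E *.
strictify E H; strictify (Δ_mul B) dm; strictify (ΔA B) dA.
by strictly; rf; rewrite dm; lf; rewrite dA; lf; rewrite H.
Qed.

(** The Hopf module projection onto left coinvariants, ω |-> S(ω_(-1)) ω_0. *)
Definition mc_proj : hom W W := δ ;; (antipode B ⊠ idm W) ;; lact W.

Lemma mc_span_proj : mc_span ;; mc_proj = (ε B ⊠ mc) ;; lunit W.
Proof.
rewrite /mc_proj !compmA mc_span_coact /mc_span.
strictify lactA la; strictify lact1 l1; strictify (antipodel B) sl.
by strictly; lf; rewrite -la; lf; rewrite sl; rf; rewrite l1.
Qed.

Let f : hom (aug B) W := aug_inc B ;; mc.
Let i : hom (ker_obj f) (aug B) := ker_inc f.

Lemma mc_kernel_stable :
  exists m : hom (ker_obj f ⊗ B) (ker_obj f),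
    ((i ;; aug_inc B) ⊠ idm B) ;; mul B = m ;; (i ;; aug_inc B).
Proof.
have [if0 kU] := ker_incP f.
have j0 : i ;; aug_inc B ;; ε B = 0 by rewrite -compmA aug_inc_counit compm0.
have jmc : i ;; aug_inc B ;; mc = 0 by rewrite -compmA.
set j := i ;; aug_inc B in j0 jmc *.
have jm : (j ⊠ idm B) ;; mul B ;; ε B = 0.
  by rewrite -compmA ε_mul compmA -tensm_comp j0 tens0m comp0m.
have [m [mE _]] : exists! m, m ;; i = (j ⊠ idm B) ;; mul B ;; aug_proj B.
  apply: kU; rewrite /f compmA -(aug_factor jm) -compmA mul_mc compmDr.
  rewrite (compmA _ (ε B ⊠ mc)) -tensm_comp j0 tens0m comp0m addr0.
  (* Naturality carries the inclusion [j] of the kernel through the braiding to [mc], which it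
     annihilates. *)
  have -> : (j ⊠ idm B) ;; ((idm B ⊠ Δ B) ;; braid_past B B B
      ;; (antipode B ⊠ ((mc ⊠ idm B) ;; ract W)) ;; lact W)
    = (idm _ ⊠ Δ B) ;; braid_past _ B B
      ;; (antipode B ⊠ (((j ;; mc) ⊠ idm B) ;; ract W)) ;; lact W.
    strictify (braid_nat j (idm B)) s1.
    by strictly; rf; rewrite s1; lf.
  by rewrite jmc tens0m comp0m tensm0 compm0 comp0m.
by exists m; rewrite /j compmA mE -(aug_factor jm).
Qed.

Definition mc_ideal : right_ideal B :=
  RightIdeal (kernel_mono (ker_incP f)) mc_kernel_stable.

Local Notation I := mc_ideal.
Local Notation Ω := (ideal_calculus I).

Lemma structure_map_ex :
  exists (φ : hom W Ω) (φ' : hom Ω W),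
    [/\ is_inverse φ φ', (idm B ⊠ cls I) ;; φ' = mc_span
      & lact Ω ;; φ' = (idm B ⊠ φ') ;; lact W].
Proof.
have [if0 _] := ker_incP f.
(* The map [e] from B⁺/I to [W] is induced by ϖ, and is mono because I is the whole kernel of ϖ on
   B⁺. *)
have [_ qU] := coker_prP i; have [e [eE _]] := qU _ _ if0.
have e_mono := coimage_mono eE.
have clsE : cls I ;; e = mc.
  rewrite /cls -compmA -[quot_pr I]/(coker_pr i) eE /f compmA aug_projE.
  by rewrite compmBl compm_idl -compmA one_mc compm0 subr0.
have [Z [k [kp cU]]] := epi_is_cokernel mc_span_epi.
(* This is a ϖ(b) |-> ε(a) [b]. It is well defined because followed by the mono [e] it becomes
   [mc_proj]. *)
have [pr [prE _]] : exists! pr, mc_span ;; pr = (ε B ⊠ cls I) ;; lunit (quot I).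
  apply: cU; apply: e_mono; rewrite comp0m.
  have <- : k ;; (mc_span ;; mc_proj) = 0 by rewrite compmA kp comp0m.
  by rewrite mc_span_proj -clsE; strictly; lf.
(* The inverse pair is ω |-> ω_(-1) ⊗ pr(ω_0) and a ⊗ [b] |-> a e([b]). *)
exists (δ ;; (idm B ⊠ pr)), ((idm B ⊠ e) ;; lact W).
have φ'E : (idm B ⊠ cls I) ;; ((idm B ⊠ e) ;; lact W) = mc_span.
  by rewrite compmA -tens_comp_r clsE.
have φE : mc_span ;; (δ ;; (idm B ⊠ pr)) = idm B ⊠ cls I.
  rewrite compmA mc_span_coact -(compmA _ _ (idm B ⊠ pr)) -tens_comp_r prE.
  by strictify (Δ_counitr B) H; strictly; lf; rewrite H.
split=> //; last first.
  cbn [forms lact ideal_calculus].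
  by strictify lactA la; strictly; rf; rewrite la; rf.
split.
  by apply: mc_span_epi; rewrite compmA φE φ'E compm_idr.
apply: (epi_tensr (W := B) (cls_epi (I := I))).
by rewrite compmA φ'E φE compm_idr.
Qed.

Lemma structure_iso :
  exists (φ : hom W Ω) (φ' : hom Ω W),
    [/\ is_inverse φ φ', is_fodc_iso φ & left_colinear δ (ideal_lcoact I) φ].
Proof.
have [φ [φ' [inv φ'E φ'l]]] := structure_map_ex; exists φ, φ'.
have [i1 i2] := inv.
have φl : lact W ;; φ = (idm B ⊠ φ) ;; lact Ω.
  rewrite -[RHS]compm_idr -i2 -compmA (compmA (lact Ω)) φ'l !compmA -tensm_comp.
  by rewrite i1 compm_idl tensm_id compm_idl.
have φd : diff W ;; φ = diff Ω.
  have -> : diff W = diff Ω ;; φ'.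
    by rewrite diff_ideal diff_mc -(compmA _ _ φ') φ'E /mc_span compmA.
  by rewrite -compmA i2 compm_idr.
have [[_ _ lr] leib _] := ideal_fodc I.
split=> //.
- split=> //; first by exists φ'.
  apply: (right_linear_of_left_linear fodcW (μ := mul B) (D := diff Ω) _ leib lr).
  + by rewrite compm_idr tensm_id compm_idl.
  + exact: φl.
  by rewrite compm_idl.
(* Colinearity is checked on elements a ϖ(b), where both coactions act as Δ on a. *)
rewrite /left_colinear; apply: (iso_epi (f := φ') (g := φ)); first by split.
rewrite compmA i2 compm_idl.
apply: (epi_tensr (W := B) (cls_epi (I := I))).
rewrite !compmA φ'E mc_span_coact -φ'E /ideal_lcoact; cbn [forms ideal_calculus].
cbn [forms ideal_calculus] in i2; strictify i2 H.
by strictly; lf; rewrite H.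
Qed.

End LeftCovariant.

Lemma bicovariant_structure (δl : hom W (B ⊗ W)) (δr : hom W (W ⊗ B)) :
  bicovariant δl δr ->
  exists (I : right_ideal B)
         (δr' : hom (ideal_calculus I) (ideal_calculus I ⊗ B))
         (φ : hom W (ideal_calculus I)),
    [/\ coAdR_stable I, is_ideal_rcoact δr', is_fodc_iso φ,
        left_colinear δl (ideal_lcoact I) φ
      & right_colinear δr δr' φ].
Proof.
move=> [covl covr]; have [φ [φ' [[i1 i2] isoφ colφ]]] := structure_iso covl.
set I := mc_ideal in φ φ' i1 i2 isoφ colφ *.
have [_ φl _ φd] := isoφ; have [_ _ _ δd] := covr.
have φ'l : lact (ideal_calculus I) ;; φ' = (idm B ⊠ φ') ;; lact W.
  rewrite -[RHS]compm_idr -i1 -compmA (compmA (lact W)) φl !compmA -tensm_comp.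
  by rewrite i2 compm_idl tensm_id compm_idl.
(* The right coaction is transported along φ; it remains left linear and compatible with d, so it is
   covariant and must be given by the formula. *)
exists I, (φ' ;; δr ;; (φ ⊠ idm B)), φ.
have lin : lact (ideal_calculus I) ;; (φ' ;; δr ;; (φ ⊠ idm B))
    = (Δ B ⊠ (φ' ;; δr ;; (φ ⊠ idm B)))
      ;; btens (lact (ideal_calculus I)) (mul B).
  rewrite !compmA φ'l -(compmA _ (lact W)) (right_covariant_lact fodcW covr).
  rewrite !compmA -tensm_comp compm_idl -(compmA _ (btens _ _)).
  rewrite (btens_morph (h := φ) (h' := idm B) φl (k' := mul B) (f' := idm B)
    (g' := idm B)); last by rewrite tensm_id compm_idl compm_idr.
  by rewrite compmA -tensm_comp tensm_id compm_idr.
have dE : diff (ideal_calculus I) ;; (φ' ;; δr ;; (φ ⊠ idm B))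
    = Δ B ;; (diff (ideal_calculus I) ⊠ idm B).
  rewrite -φd !compmA -(compmA _ φ φ') i1 compm_idr δd -compmA.
  by rewrite -tensm_comp compm_idr.
have cov := right_covariantI (ideal_fodc I) lin dE.
have lift := right_covariant_lift cov.
split=> //.
(* The formula factors through the class map, hence vanishes on B ⊗ I. *)
- apply/coAdR_stableP; rewrite -lift compmA -tens_comp_r ideal_inc_cls.
  by rewrite tensm0 comp0m.
- exact/rcoact_formula_lift.
by rewrite /right_colinear !compmA i1 compm_idl.
Qed.

End Structure.

Theorem theorem2p12 (M : abelian_braided_category) (B : hopf_algebra M) :
  (forall I : right_ideal B,
     left_covariant (ideal_lcoact I)
     /\ (coAdR_stable I ->
         exists δr : hom (ideal_calculus I) (ideal_calculus I ⊗ B),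
           is_ideal_rcoact δr /\ bicovariant (ideal_lcoact I) δr))
  /\ (forall (W : calculus_data B) (δl : hom W (B ⊗ W)),
        left_covariant δl ->
        exists (I : right_ideal B) (φ : hom W (ideal_calculus I)),
          is_fodc_iso φ /\ left_colinear δl (ideal_lcoact I) φ)
  /\ (forall (W : calculus_data B) (δl : hom W (B ⊗ W)) (δr : hom W (W ⊗ B)),
        bicovariant δl δr ->
        exists (I : right_ideal B)
               (δr' : hom (ideal_calculus I) (ideal_calculus I ⊗ B))
               (φ : hom W (ideal_calculus I)),
          [/\ coAdR_stable I, is_ideal_rcoact δr', is_fodc_iso φ,
              left_colinear δl (ideal_lcoact I) φ
            & right_colinear δr δr' φ]).
Proof.
split=> [I|]; first split; first exact: ideal_left_covariant.
  exact: ideal_bicovariant.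
split=> W δl.
  move=> cov; have [fodcW _ _ _] := cov.
  have [φ [φ' [_ isoφ colφ]]] := structure_iso fodcW cov.
  by exists (mc_ideal fodcW), φ.
move=> δr cov; have [[fodcW _ _ _] _] := cov.
exact: (bicovariant_structure fodcW cov).
Qed.
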